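(* Let $v:\mathbb X\times\mathbb X\to[0,\infty]$ be a measurable symmetric pair potential and $z:\mathbb X\to[0,\infty)$ measurable with $\int_B z\,d\lambda<\infty$ for all $B\in\mathcal X_{\mathsf b}$. Suppose there exists a measurable $a:\mathbb X\to[0,\infty)$ such that for $\lambda$-almost all $x_0\in\mathbb X$, $$\sum_{k=1}^\infty\frac{1}{k!}\int_{\mathbb X^k}\prod_{j=1}^k|f(x_0,y_j)|\prod_{1\le i<j\le k}\bigl(1+f(y_i,y_j)\bigr)\prod_{j=1}^k z(y_j)e^{a(y_j)}\,d\lambda^k(\mathbf y)\le e^{a(x_0)}-1.$$ Then for all $n\in\mathbb N$ and $\lambda^n$-almost all $(x_1,\dots,x_n)\in\mathbb X^n$, $$|\psi_{n,n}(x_1,\dots,x_n)|+\sum_{k=1}^\infty\frac{1}{k!}\int_{\mathbb X^k}|\psi_{n,n+k}(x_1,\dots,x_n,y_1,\dots,y_k)|\,d\lambda_z^k(\mathbf y)\le\prod_{1\le i<j\le n}\bigl(1+f(x_i,x_j)\bigr)e^{\sum_{i=1}^na(x_i)},$$ and for every $\Lambda\in\mathcal X_{\mathsf b}$ with $\lambda_z(\Lambda)>0$ the correlation functions $\rho_{n,\Lambda}$ of $\mathsf P_\Lambda$ satisfy, for $\lambda^n$-almost all $(x_1,\dots,x_n)\in\Lambda^n$, $$\rho_{n,\Lambda}(x_1,\dots,x_n)=\prod_{j=1}^nz(x_j)\Bigl(\psi_{n,n}(x_1,\dots,x_n)+\sum_{k=1}^\infty\frac1{k!}\int_{\Lambda^k}\psi_{n,n+k}(x_1,\dots,x_n,y_1,\dots,y_k)\,d\lambda_z^k(\mathbf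 y)\Bigr).$$
   Context: $(\mathbb X,\mathrm{dist})$ is a complete separable metric space with Borel $\sigma$-algebra $\mathcal X$, $\mathcal X_{\mathsf b}$ the bounded Borel sets, $\lambda$ a measure finite on bounded sets; $\lambda_z(dx)=z(x)\lambda(dx)$; $f(x,y)=e^{-v(x,y)}-1$ (with $e^{-\infty}=0$). For bounded $\Lambda$ with $\lambda_z(\Lambda)>0$, $\mathsf P_\Lambda$ is the finite-volume Gibbs measure with empty boundary conditions: the probability measure on counting measures supported in $\Lambda$ that is absolutely continuous w.r.t. the Poisson point process with intensity $\mathbf 1_\Lambda\lambda_z$ with density proportional to $\eta=\sum_{i=1}^n\delta_{x_i}\mapsto e^{-\sum_{1\le i<j\le n}v(x_i,x_j)}$. Its correlation functions $\rho_{n,\Lambda}$ are the densities w.r.t. $\lambda^n$ of its factorial moment measures, i.e. $\mathsf E_\Lambda[\int g\,d\eta^{(n)}]=\int g\rho_{n,\Lambda}\,d\lambda^n$ for measurable $g\ge0$, where $\eta^{(n)}$ is the $n$-th factorial measure ($\int g\,d\eta^{(n)}$ is the sum of $g(x_{i_1},\dots,x_{i_n})$ over pairwise distinct indices). For $k\le n$, $\mathcal D_{k,n}$ is the set of simple graphs on $\{1,\dots,n\}$ in which every vertex in $\{k+1,\dots,n\}$ is joined by a path to some vertex of $\{1,\dots,k\}$, and $\psi_{k,n}(x_1,\dots,x_n)=\sum_{G\in\mathcal D_{k,n}}\prod_{\{i,j\}\in E(G)}f(x_i,x_j)$. *)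

(* Defs.v *)
From HB Require Import structures.
From mathcomp Require Import all_boot all_order all_algebra.
From mathcomp Require Import all_classical all_reals all_analysis.
From mathcomp Require Import measurable_realfun.

Set Implicit Arguments.
Unset Strict Implicit.
Unset Printing Implicit Defensive.
Import Order.TTheory GRing.Theory Num.Theory.
Import numFieldNormedType.Exports.
Local Open Scope classical_set_scope.
Local Open Scope ring_scope.

Section Defs.
Context {d : measure_display} {T : measurableType d} {R : realType}.

Definition is_metric (dist : T -> T -> R) : Prop :=
  [/\ forall x y, 0 <= dist x y,
      forall x y, dist x y = 0 <-> x = y,
      forall x y, dist x y = dist y x &
      forall x y z, dist x z <= dist x y + dist y z].

Definition mball (dist : T -> T -> R) (x : T) (r : R) : set T :=
  [set y | dist x y < r].

Definition metric_open (dist : T -> T -> R) (U : set T) : Prop :=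
  forall x, U x -> exists2 r : R, 0 < r & mball dist x r `<=` U.

Definition metric_complete (dist : T -> T -> R) : Prop :=
  forall u : nat -> T,
    (forall e : R, 0 < e -> exists N, forall m n, (N <= m)%N -> (N <= n)%N ->
       dist (u m) (u n) < e) ->
    exists l, forall e : R, 0 < e -> exists N, forall n, (N <= n)%N -> dist (u n) l < e.

Definition metric_separable (dist : T -> T -> R) : Prop :=
  exists S : set T, countable S /\
    forall x (e : R), 0 < e -> exists2 s, S s & dist x s < e.

Definition borel_of (dist : T -> T -> R) : Prop :=
  @measurable d T = <<s metric_open dist >>.

Definition mbounded (dist : T -> T -> R) (A : set T) : Prop :=
  exists x r, A `<=` mball dist x r.

(* wint mu D w n F = \int_{D^n} F(x_1..x_n) prod_j w(x_j) d mu^n(x), computed as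
   an iterated integral (first coordinate outermost); for nonnegative F this is
   the integral w.r.t. the n-fold product measure (Tonelli). *)
Fixpoint wint (mu : set T -> \bar R) (D : set T) (w : T -> R) (n : nat)
  : (n.-tuple T -> \bar R) -> \bar R :=
  match n return (n.-tuple T -> \bar R) -> \bar R with
  | 0 => fun F => F [tuple]
  | n'.+1 => fun F =>
      (\int[mu]_(x in D) ((w x)%:E * wint mu D w (fun t => F (cons_tuple x t))))%E
  end.

Definition swint (mu : set T -> \bar R) (D : set T) (w : T -> R) (n : nat)
  (F : n.-tuple T -> \bar R) : \bar R :=
  (wint mu D w F^\+ - wint mu D w F^\-)%E.

Definition prodm (mu : set T -> \bar R) (n : nat) (A : set (n.-tuple T)) : \bar R :=
  wint mu setT (fun=> 1) (fun x => (\1_A x)%:E).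

Definition ae_prod (mu : set T -> \bar R) (n : nat) (P : n.-tuple T -> Prop) : Prop :=
  exists N : set (n.-tuple T),
    [/\ measurable N, prodm mu N = 0%E & forall x, ~ N x -> P x].

Definition mayer (v : T -> T -> \bar R) (x y : T) : R :=
  fine (expeR (- v x y)%E) - 1.

Definition simple_graph n (G : {set 'I_n * 'I_n}) : bool :=
  [forall e in G, (e.1 < e.2)%N].

Definition gadj n (G : {set 'I_n * 'I_n}) : rel 'I_n :=
  fun i j => ((i, j) \in G) || ((j, i) \in G).

Definition Dkn (k n : nat) : {set {set 'I_n * 'I_n}} :=
  [set G | simple_graph G &&
    [forall j : 'I_n, (k <= j)%N ==> [exists i : 'I_n, (i < k)%N && connect (gadj G) j i]]].

Definition psi (v : T -> T -> \bar R) (k n : nat) (x : n.-tuple T) : R :=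
  \sum_(G in Dkn k n) \prod_(e in G) mayer v (tnth x e.1) (tnth x e.2).

(* A functional of finite configurations eta = sum_i delta_{x_i} is given by its
   (symmetric) values on m-tuples (x_1..x_m), for every m. *)
Definition config_fun := forall m : nat, m.-tuple T -> \bar R.

(* E[F(eta)] for the Poisson process with finite intensity w(x) lambda(dx) on D *)
Definition poissonE (lam : set T -> \bar R) (D : set T) (w : T -> R)
  (F : config_fun) : \bar R :=
  (expeR (- \int[lam]_(x in D) (w x)%:E) *
   \sum_(m <oo) ((m`!%:R)^-1%:E * wint lam D w (F m)))%E.

Definition boltz (v : T -> T -> \bar R) : config_fun :=
  fun m x => expeR (- \sum_(i < m) \sum_(j < m | (i < j)%N) v (tnth x i) (tnth x j))%E.

(* expectation under the finite-volume Gibbs measure P_Lambda with empty boundary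
   conditions: density proportional to the Boltzmann factor w.r.t. the Poisson
   process with intensity 1_Lambda lambda_z *)
Definition gibbsE (lam : set T -> \bar R) (z : T -> R) (v : T -> T -> \bar R)
  (L : set T) (F : config_fun) : \bar R :=
  (poissonE lam L z (fun m x => F m x * boltz v x) *
   (fine (poissonE lam L z (boltz v)))^-1%:E)%E.

(* int g d eta^(n): sum over pairwise distinct indices *)
Definition fact_sum (n : nat) (g : n.-tuple T -> \bar R) : config_fun :=
  fun m x => (\sum_(s : {ffun 'I_n -> 'I_m} | injectiveb s)
                g [tuple tnth x (s i) | i < n])%E.

Definition is_correlation_fun (lam : set T -> \bar R) (z : T -> R)
  (v : T -> T -> \bar R) (L : set T) (n : nat) (rho : n.-tuple T -> \bar R) : Prop :=
  [/\ measurable_fun setT rho, (forall x, 0 <= rho x)%E &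
      forall g : n.-tuple T -> \bar R, measurable_fun setT g -> (forall x, 0 <= g x)%E ->
        gibbsE lam z v L (fact_sum g) =
        wint lam setT (fun=> 1) (fun x => g x * rho x)%E].

End Defs.

(* Main.v *)
Require Import Defs.
From HB Require Import structures.
From mathcomp Require Import all_boot all_order all_algebra.
From mathcomp Require Import all_classical all_reals all_analysis.
From mathcomp Require Import measurable_realfun zify ring lra.
Import Order.TTheory GRing.Theory Num.Theory.
Import numFieldNormedType.Exports.
Local Open Scope ring_scope.

(** Deleting the root [x] from a graph in which every other vertex reaches a root turns
    its neighbours into roots; this gives the Kirkwood-Salsburg recursion
      [psi(x :: xs; ys) = prod_(x' in xs) (1 + f x x') *
         sum_(u + w = ys) prod_(y in u) f x y * psi(xs ++ u; w)],
    the sum being over splittings of [ys] into two complementary subsequences.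
    As [-1 <= f <= 0], [psi(xs; ys)] has the sign of [(-1)^|ys|], so [|psi|] satisfies
    the same recursion with [|f|]. The truncated series
    [sum_(k <= K) int |psi_(n,n+k)| / k!] are then bounded by induction on [n + K]:
    integrating the recursion reproduces the left-hand side of the convergence
    condition, [1 + (e^(a x) - 1)] being the factor gained by the new root.

    The Boltzmann factor [E] satisfies the same recursion without restriction on the
    vertices, so [E(xs ++ ys) = sum_(u + w = ys) psi(xs; u) * E(w)]. Integrated and
    summed, this is a Cauchy product:
    [sum_m int E(xs, .) / m! = Xi * sum_k int psi(xs, .) / k!]. The factorial moments of
    the Gibbs measure have density [prod z * Xi^-1 * sum_m int E(xs, .) / m!], and
    densities are unique almost everywhere. *)

(** * Rooted graphs and the Kirkwood-Salsburg recursion *)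

Section Graphs.
Import mathcomp.boot.finset.

(** * Sums over the splittings of a sequence *)

Section Splitting.
Context {T : Type} {M : nmodType}.

(** Working with splittings of sequences is what lets the recursion be integrated. Integrals are
    iterated, one coordinate after another, and by Tonelli every splitting of [k] integration
    variables into [i] and [k - i] contributes the same amount, whether or not the integrand is
    symmetric. There are ['C(k, i)] such splittings and ['C(k, i) / k! = 1 / (i! (k - i)!)], which
    produces the factorials of both series.

    Convergence cannot be presupposed, hence the truncation at [K] added vertices. The recursion
    respects it: promoting [i] vertices leaves [n - 1 + i] roots and at most [K - i] other vertices,
    so [n + K] drops by exactly one.

    Repulsion enters twice. The fixed sign lets absolute values pass through the recursion without
    loss, and [E(xs ++ u) <= E(xs) * E(u)] splits off the factor [E(u)] present in the convergence
    condition while the bound keeps [E(xs)].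

    The condition holds only outside a null set, so the bound is proved for roots in a set [good] of
    full measure, and the integration variables are restricted to that set as well before they
    become roots. *)

Fixpoint split_sum (G : seq T -> seq T -> M) (s : seq T) : M :=
  if s is y :: s' then
    split_sum (fun u w => G (y :: u) w) s' + split_sum (fun u w => G u (y :: w)) s'
  else G [::] [::].

Lemma eq_split_sum (G H : seq T -> seq T -> M) s :
  (forall u w, (size u + size w = size s)%N -> G u w = H u w) ->
  split_sum G s = split_sum H s.
Proof.
elim: s G H => [|y s IH] G H GH /=; first exact: GH.
by congr (_ + _); apply: IH => u w uw; apply: GH; rewrite /= -uw ?addSn ?addnS.
Qed.

Lemma split_sumD (G H : seq T -> seq T -> M) s :
  split_sum (fun u w => G u w + H u w) s = split_sum G s + split_sum H s.
Proof.
by elim: s G H => [//|y s IH] G H /=; rewrite !IH addrACA.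
Qed.

End Splitting.

Lemma eq_in_split_sum {T : eqType} {M : nmodType} (G H : seq T -> seq T -> M) s :
  (forall u w, perm_eq (u ++ w) s -> G u w = H u w) -> split_sum G s = split_sum H s.
Proof.
elim: s G H => [|y s IH] G H GH /=; first exact: GH.
congr (_ + _); apply: IH => u w uw; apply: GH; first by rewrite /= perm_cons.
by rewrite perm_catC /= perm_cons perm_catC.
Qed.

Lemma split_sum_map {T U : Type} {M : nmodType} (f : T -> U)
  (G : seq U -> seq U -> M) s :
  split_sum G (map f s) = split_sum (fun u w => G (map f u) (map f w)) s.
Proof. by elim: s G => [//|y s IH] G /=; rewrite !IH. Qed.

(** Both sides enumerate the splittings into three complementary subsequences [u], [u'], [w]. *)
Lemma split_sumA {T : Type} {M : nmodType} (H : seq T -> seq T -> seq T -> M) s :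
  split_sum (fun u r => split_sum (fun u' w => H u u' w) r) s =
  split_sum (fun r w => split_sum (fun u u' => H u u' w) r) s.
Proof.
by elim: s H => [//|y s IH] H /=; rewrite split_sumD !split_sumD !IH addrA.
Qed.

Lemma split_sumZ {T : Type} {S : pzRingType} (c : S) (G : seq T -> seq T -> S) s :
  split_sum (fun u w => c * G u w) s = c * split_sum G s.
Proof. by elim: s G => [//|y s IH] G /=; rewrite !IH mulrDr. Qed.

Lemma split_sumMr {T : Type} {S : pzRingType} (c : S) (G : seq T -> seq T -> S) s :
  split_sum (fun u w => G u w * c) s = split_sum G s * c.
Proof. by elim: s G => [//|y s IH] G /=; rewrite !IH mulrDl. Qed.

Lemma split_sum_prod {T : Type} {S : comPzRingType} (g : T -> S) (s : seq T) :
  split_sum (fun u _ => \prod_(y <- u) g y) s = \prod_(y <- s) (1 + g y).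
Proof.
elim: s => [|y s IH] /=; first by rewrite !big_nil.
rewrite big_cons -IH mulrDl mul1r addrC; congr (_ + _).
by rewrite -split_sumZ; apply: eq_split_sum => u w _; rewrite big_cons.
Qed.

Section SubsetSums.
Context {I : finType} {M : nmodType}.
Local Open Scope ring_scope.
Implicit Types (X Y : {set I}) (F : {set I} -> M).

Lemma sum_subsetU X Y F : [disjoint X & Y] ->
  \sum_(G : {set I} | G \subset X :|: Y) F G =
  \sum_(G1 : {set I} | G1 \subset X) \sum_(G2 : {set I} | G2 \subset Y) F (G1 :|: G2).
Proof.
move=> dXY; have XY0 : X :&: Y = set0 by apply/eqP; rewrite setI_eq0.
rewrite pair_big_dep /=.
rewrite (reindex_onto (fun p : {set I} * {set I} => p.1 :|: p.2)
  (fun G => (G :&: X, G :&: Y))) /=; last first.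
  by move=> G /setIidPl GXY; rewrite -setIUr.
apply: eq_bigl => -[G1 G2] /=; apply/andP/andP => -[].
  move=> _ /eqP[<- <-]; split; exact: subsetIr.
move=> G1X G2Y; split; first exact: setUSS.
rewrite !setIUl (setIidPl G1X) (setIidPl G2Y).
have -> : G2 :&: X = set0.
  by apply/eqP; rewrite setI_eq0 disjoint_sym; apply: disjointWr G2Y _.
have -> : G1 :&: Y = set0 by apply/eqP; rewrite setI_eq0; apply: disjointWl G1X _.
by rewrite setU0 set0U.
Qed.

Lemma sum_subset1 (a : I) F :
  \sum_(G : {set I} | G \subset [set a]) F G = F set0 + F [set a].
Proof.
rewrite (bigD1 set0) ?sub0set //= (bigD1 [set a]) /=; last first.
  rewrite subxx; apply/eqP => /setP /(_ a); by rewrite !inE eqxx.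
rewrite big1 ?addr0 // => G /andP[/andP[]]; rewrite subset1 => /orP[->//|->//].
Qed.

(** Links the two descriptions of a choice of vertices: without repetitions, subsequences of [s]
    correspond to subsets of its set of entries. *)
Lemma split_sum_set (K : {set I} -> {set I} -> M) (s : seq I) : uniq s ->
  split_sum (fun u w => K [set:: u] [set:: w]) s =
  \sum_(J : {set I} | J \subset [set:: s]) K J ([set:: s] :\: J).
Proof.
elim: s K => [|y s IH] K /=.
  rewrite set_nil => _; rewrite (big_pred1 set0) ?setD0 // => J; exact: subset0.
move=> /andP[ys us]; rewrite set_cons sum_subsetU; last first.
  by rewrite disjoints1 inE.
rewrite sum_subset1 addrC; congr (_ + _).
  under eq_split_sum do rewrite set_cons.
  rewrite (IH (fun A B => K A (y |: B))) //; apply: eq_bigr => J Js.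
  rewrite set0U; congr (K _ _); apply/setP => x; rewrite !inE.
  case: (eqVneq x y) => // ->; rewrite /= andbT; apply/esym/negP => yJ.
  by move/fintype.subsetP: Js => /(_ _ yJ); rewrite inE (negPf ys).
under eq_split_sum do rewrite set_cons.
rewrite (IH (fun A B => K (y |: A) B)) //; apply: eq_bigr => J Js.
congr (K _ _); apply/setP => x; rewrite !inE.
by case: (eqVneq x y) => //= ->; rewrite (negPf ys) andbF.
Qed.

End SubsetSums.

Lemma sum_subset_imset {I I' : finType} {M : nmodType} (f : I -> I')
  (C : {set I}) (F : {set I'} -> M) : {in C &, injective f} ->
  \sum_(G : {set I'} | G \subset f @: C) F G =
  \sum_(N : {set I} | N \subset C) F (f @: N).
Proof.
move=> injf; rewrite (reindex_onto (fun N : {set I} => f @: N) (fun G : {set I'} => C :&: f @^-1: G)) /=.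
  apply: eq_bigl => N; apply/andP/idP => [[_ /eqP <-]|NC]; first exact: subsetIl.
  split; first exact: imsetS.
  apply/eqP/setP => x; rewrite !inE; apply/andP/idP => [[xC /imsetP[y yN fxy]]|xN].
    by rewrite (injf _ _ xC _ fxy) // (fintype.subsetP NC).
  by split; [exact: (fintype.subsetP NC)|exact: imset_f].
move=> G /fintype.subsetP GC; apply/setP => e; apply/imsetP/idP.
  by move=> [x]; rewrite !inE => /andP[_ ?] ->.
move=> eG; have /imsetP[x xC ex] := GC _ eG.
by exists x => //; rewrite !inE xC -ex.
Qed.

Lemma sum_subset_prod {I : finType} {S : comPzRingType} (A : {set I}) (g : I -> S) :
  \sum_(M : {set I} | M \subset A) \prod_(i in M) g i = \prod_(i in A) (1 + g i).
Proof.
pose g' i := if i \in A then g i else 0.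
transitivity (\prod_i (1 + g' i)); last first.
  by rewrite [RHS]big_mkcond; apply: eq_bigr => i _; rewrite /g'; case: ifP; rewrite ?addr0.
under [RHS]eq_bigr do rewrite addrC.
rewrite bigA_distr [LHS]big_mkcond [RHS](eq_bigl xpredT) //; apply: eq_bigr => M _. case: ifP => [MA|].
  rewrite [LHS]big_mkcond; apply: eq_bigr => i _; case: ifP => // iM.
  by rewrite /g' (fintype.subsetP MA).
by move=> /negbT/subsetPn[i iM iA]; rewrite (bigD1 i) //= iM /g' (negPf iA) mul0r.
Qed.


Section RootedGraphs.
Context {N : nat} {S : comPzRingType} (h : 'I_N -> 'I_N -> S).
Hypothesis hC : forall i j, h i j = h j i.
Implicit Types (A B C M : {set 'I_N}) (G : {set 'I_N * 'I_N}).

Definition edges_in C : {set 'I_N * 'I_N} :=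
  [set e : 'I_N * 'I_N | [&& (e.1 < e.2)%N, e.1 \in C & e.2 \in C]].

Definition rooted A B G : bool :=
  [forall b in B, [exists a in A, connect (gadj G) b a]].

(** This is [psi] with arbitrary vertex sets [A] of roots and [B] of other vertices. The generality
    is needed because the recursion deletes one root and promotes some vertices, after which the
    roots are no longer an initial segment. *)
Definition rooted_sum A B : S :=
  \sum_(G : {set 'I_N * 'I_N} | (G \subset edges_in (A :|: B)) && rooted A B G)
     \prod_(e in G) h e.1 e.2.

(** Graphs store each edge with its smaller end first, so an edge at [a] has to be oriented. *)
Definition edge (a s : 'I_N) : 'I_N * 'I_N :=
  if (a < s)%N then (a, s) else (s, a).

Lemma edge_inj a C : a \notin C -> {in C &, injective (edge a)}.
Proof.
move=> aC s1 s2 s1C s2C; rewrite /edge.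
by case: ifP => _; case: ifP => _ [] // e1 e2; move: aC s1C s2C; rewrite ?e1 ?e2 => /negP.
Qed.

Lemma gadj_sym G : symmetric (gadj G).
Proof. by move=> x y; rewrite /gadj orbC. Qed.

Lemma edges_inU1 a C : a \notin C ->
  edges_in (a |: C) = edges_in C :|: edge a @: C.
Proof.
move=> aC; apply/setP => -[i j]; rewrite !inE /=.
apply/idP/orP => [/and3P[ij /orP[/eqP ia|iC] /orP[/eqP ja|jC]]|].
- by rewrite ia ja ltnn in ij.
- by right; apply/imsetP; exists j => //; rewrite /edge -ia ij.
- by right; apply/imsetP; exists i => //; rewrite /edge -ja ltnNge (ltnW ij).
- by left; rewrite ij iC.
- move=> [/and3P[-> -> ->]|]; first by rewrite !orbT.
  move=> /imsetP[s sC]; rewrite /edge; case: ltngtP => // [ias|sa|/val_inj ias] [-> ->].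
  + by rewrite ias eqxx sC orbT.
  + by rewrite sa eqxx sC orbT.
  + by rewrite ias sC in aC.
Qed.

Lemma edges_in_star_disjoint a C : a \notin C -> [disjoint edges_in C & edge a @: C].
Proof.
move=> aC; rewrite -setI_eq0; apply/eqP/setP => -[i j]; rewrite !inE /=.
apply/negP => /andP[/and3P[_ iC jC] /imsetP[s sC]]; rewrite /edge.
by case: ifP => _ [i1 j1]; move: aC; rewrite -?i1 -?j1 ?iC ?jC.
Qed.

Lemma gadj_star a C G M x y : a \notin C -> M \subset C ->
  gadj (G :|: edge a @: M) x y =
  [|| gadj G x y, (x == a) && (y \in M) | (y == a) && (x \in M)].
Proof.
move=> aC MC; have aM : a \notin M by apply: contra aC; apply/fintype.subsetP.
rewrite /gadj !inE.
have H u w : ((u, w) \in edge a @: M) =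
    ((u == a) && (w \in M) && (u < w)%N) || ((w == a) && (u \in M) && (u < w)%N).
  apply/imsetP/orP => [[s sM]|[/andP[/andP[/eqP -> wM] aw]|/andP[/andP[/eqP -> uM] ua]]].
  - rewrite /edge; case: ltngtP => // [ias|sa|/val_inj ias] [-> ->].
    + by left; rewrite eqxx sM.
    + by right; rewrite eqxx sM.
    + by rewrite ias sM in aM.
  - by exists w => //; rewrite /edge aw.
  - by exists u => //; rewrite /edge ltnNge (ltnW ua).
rewrite !H.
have [->|xa] := eqVneq x a; have [->|ya] := eqVneq y a; rewrite /= ?(negPf aM) ?orbF //=.
- case yM: (y \in M); rewrite /= ?orbF //.
  have : y != a by apply: contraTneq yM => ->.
  rewrite -(inj_eq val_inj) /= neq_ltn => /orP[] ->; rewrite ?orbT //.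
- case xM: (x \in M); rewrite /= ?orbF //.
  rewrite -(inj_eq val_inj) /= neq_ltn in xa.
  by case/orP: xa => ->; rewrite ?orbT.
Qed.

(* A walk to the root [a] in the graph with star [M] around [a] reaches [M] just
   before its first visit to [a]; so the neighbours of [a] become roots. *)
Lemma rooted_star a A B G M :
  a \notin A :|: B -> M \subset A :|: B -> G \subset edges_in (A :|: B) ->
  rooted (a |: A) B (G :|: edge a @: M) = rooted (A :|: (B :&: M)) (B :\: M) G.
Proof.
move=> aC MC GC; set G' := G :|: _; set A' := A :|: (B :&: M).
have gG' x y : gadj G' x y =
  [|| gadj G x y, (x == a) && (y \in M) | (y == a) && (x \in M)].
  exact: gadj_star aC MC.
have aG x y : gadj G x y -> x != a.
  rewrite /gadj; move=> /orP[] /(fintype.subsetP GC); rewrite !inE /= => /and3P[_ ? ?];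
  by apply: contraNneq aC => <-; rewrite inE.
have MA' s : s \in M -> s \notin B -> s \in A.
  by move=> /(fintype.subsetP MC); rewrite inE => /orP[//|->].
have aB b : b \in B -> b != a.
  by move=> bB; apply: contraNneq aC => <-; rewrite inE bB orbT.
(* A closure argument replaces the cutting of a walk: [X] is closed under adjacency in [G'] and
   contains all old roots, hence every vertex that reaches one of them. *)
pose X := [pred x | (x == a) || [exists r in A', connect (gadj G) x r]].
have MX s : s \in M -> s \in A'.
  move=> sM; rewrite /A' !inE sM andbT; case sB : (s \in B); rewrite ?orbT //.
  by rewrite MA' ?sB.
have Xcl : fingraph.closed (gadj G') X.
  apply: intro_closed; first exact: sym_connect_sym (gadj_sym G').
  move=> x y; rewrite gG' !inE => /or3P[xy|/andP[/eqP -> yM] _|/andP[/eqP -> ?] _].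
  - rewrite (negPf (aG _ _ xy)) /= => /existsP[r /andP[rA' xr]]; apply/orP; right.
    apply/existsP; exists r; rewrite rA' /=; apply: connect_trans xr.
    by apply: connect1; rewrite gadj_sym.
  - by apply/orP; right; apply/existsP; exists y; rewrite MX //= connect0.
  - by rewrite eqxx.
apply/forallP/forallP => H b; apply/implyP.
  rewrite inE => /andP[bM bB].
  move: (H b); rewrite bB => /existsP[r /andP[rA br]].
  have : b \in X.
    rewrite (closed_connect Xcl br) !inE; move: rA; rewrite !inE => /orP[->//|rA].
    by apply/orP; right; apply/existsP; exists r; rewrite connect0 andbT !inE rA.
  by rewrite !inE (negPf (aB _ bB)).
move=> bB; have sG : subrel (connect (gadj G)) (connect (gadj G')).
  by apply: connect_sub => x y xy; apply: connect1; rewrite gG' xy.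
have aM s : s \in M -> connect (gadj G') s a.
  by move=> sM; apply: connect1; rewrite gG' sM eqxx !orbT.
case bM : (b \in M); first by apply/existsP; exists a; rewrite !inE eqxx aM.
move: (H b); rewrite !inE bM bB => /existsP[r /andP[]].
rewrite !inE => /orP[rA|/andP[_ rM]] /sG br; apply/existsP.
  by exists r; rewrite !inE rA orbT.
by exists a; rewrite !inE eqxx /=; apply: connect_trans br (aM _ rM).
Qed.

(** A graph on [a |: (A :|: B)] is a graph on [A :|: B] together with the neighbours of [a], namely
    [M1] in [A] and [J] in [B]. Those in [A] are roots already, so [M1] is unconstrained and its sum
    factors into the product of the [1 + h a i]; those in [B] become roots. *)
Lemma rooted_sum_step a A B : a \notin A :|: B -> [disjoint A & B] ->
  rooted_sum (a |: A) B = \prod_(i in A) (1 + h a i) *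
    \sum_(J : {set 'I_N} | J \subset B)
       \prod_(j in J) h a j * rooted_sum (A :|: J) (B :\: J).
Proof.
move=> aC dAB; rewrite /rooted_sum -setUA edges_inU1 // big_mkcondr /=.
rewrite sum_subsetU; last exact: edges_in_star_disjoint.
rewrite exchange_big /= sum_subset_imset; last exact: edge_inj aC.
rewrite sum_subsetU // -sum_subset_prod mulr_suml.
apply: eq_bigr => M1 M1A; rewrite mulr_sumr; apply: eq_bigr => J JB.
have MC : M1 :|: J \subset A :|: B by exact: setUSS.
have B1 : B :&: M1 = set0.
  by apply/eqP; rewrite setIC setI_eq0; apply: disjointWl M1A _.
have BJ : B :&: (M1 :|: J) = J by rewrite setIUr B1 set0U (setIidPr JB).
have DJ : B :\: (M1 :|: J) = B :\: J.
  apply/setP => x; rewrite !inE; case xB : (x \in B); rewrite ?andbF // negb_or.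
  by have /setP /(_ x) := B1; rewrite !inE xB /= => ->.
have UJ : A :|: J :|: (B :\: J) = A :|: B.
  apply/setP => x; rewrite !inE; case xJ : (x \in J); rewrite ?orbF //.
  by rewrite (fintype.subsetP JB _ xJ) !orbT.
rewrite UJ mulrA -big_mkcondr big_distrr /=.
rewrite [LHS](eq_bigl (fun G => (G \subset edges_in (A :|: B)) && rooted (A :|: J) (B :\: J) G)); last first.
  by move=> G /=; case GC : (G \subset _) => //=; rewrite rooted_star // BJ DJ.
apply: eq_bigr => G /andP[GC _].
have dG : [disjoint G & edge a @: (M1 :|: J)].
  apply: disjointWl GC _; apply: disjointWr (edges_in_star_disjoint _ _ aC).
  exact: imsetS.
rewrite (eq_bigl (fun e => e \in [predU G & edge a @: (M1 :|: J)])); last first.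
  by move=> e; rewrite !inE.
rewrite bigU //= mulrC; congr (_ * _).
rewrite big_imset /=; last first.
  by move=> x y xM yM; apply: (edge_inj _ _ aC); exact: (fintype.subsetP MC).
rewrite (eq_bigl (fun e => e \in [predU M1 & J])); last by move=> e; rewrite !inE.
rewrite bigU /=; last by apply: disjointWl M1A _; apply: disjointWr JB _.
by congr (_ * _); apply: eq_bigr => j _; rewrite /edge; case: ifP => //= _; rewrite hC.
Qed.

Lemma rooted_sum_nil B : rooted_sum set0 B = (B == set0)%:R.
Proof.
have [->|/set0Pn[b bB]] := eqVneq B set0.
  rewrite /rooted_sum (big_pred1 set0) ?big_set0 // => G.
  rewrite setU0 (_ : edges_in set0 = set0); last first.
    by apply/setP => e; rewrite !inE !andbF.
  rewrite subset0 inE andb_idr // => _.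
  by apply/forallP => b; rewrite inE.
rewrite /rooted_sum big1 // => G /andP[_ /forallP /(_ b)].
by rewrite bB => /existsP[x]; rewrite inE.
Qed.

End RootedGraphs.

Section Recursion.
Context {T : Type} {S : comPzRingType}.

(** The recursion is not structural, since [xs' ++ u] may be longer than [xs], but the total number
    of points drops by one at each step. The total size is therefore exactly enough fuel, and [psir]
    never reaches the default value 0. *)
Fixpoint psir_fuel (k : nat) (f : T -> T -> S) (xs ys : seq T) : S :=
  if xs is x :: xs' then
    if k is k'.+1 then
      \prod_(x' <- xs') (1 + f x x') *
      split_sum (fun u w => \prod_(y <- u) f x y * psir_fuel k' f (xs' ++ u) w) ys
    else 0
  else (nilp ys)%:R.

Definition psir f xs ys := psir_fuel (size xs + size ys) f xs ys.

Lemma psir_nil f ys : psir f [::] ys = (nilp ys)%:R.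
Proof. by rewrite /psir; case: (_ + _)%N. Qed.

Lemma psir_cons f x xs ys :
  psir f (x :: xs) ys = \prod_(x' <- xs) (1 + f x x') *
    split_sum (fun u w => \prod_(y <- u) f x y * psir f (xs ++ u) w) ys.
Proof.
rewrite /psir /=; congr (_ * _); apply: eq_split_sum => u w uw.
by rewrite size_cat -addnA uw.
Qed.

(** Only the vertices have to be distinct; [t] may place several of them at the same point. This is
    why the identification with graph sums goes through vertex sequences [s] and [r] and not through
    the points themselves. *)
Lemma rooted_sum_psir N (f : T -> T -> S) (t : 'I_N -> T) (s r : seq 'I_N) :
  (forall x y, f x y = f y x) -> uniq (s ++ r) ->
  rooted_sum (fun i j => f (t i) (t j)) [set:: s] [set:: r] =
  psir f (map t s) (map t r).
Proof.
move=> fC; have [k] := ubnP (size s + size r)%N.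
elim: k s r => // k IH [|a s] r /=.
  rewrite set_nil rooted_sum_nil psir_nil => _ _; congr (_%:R); congr nat_of_bool.
  case: r => [|y r] /=; first by rewrite set_nil eqxx.
  by apply/eqP => /setP /(_ y); rewrite !inE eqxx.
rewrite addSn ltnS mem_cat negb_or cat_uniq => sk /andP[/andP[ias ar] /and3P[us /hasPn sr ur]].
rewrite psir_cons big_map split_sum_map set_cons rooted_sum_step; last 3 first.
- by move=> i j; rewrite fC.
- by rewrite !inE negb_or ias.
- rewrite -setI_eq0; apply/eqP/setP => x; rewrite !inE.
  by apply/negP => /andP[xs xr]; move: (sr _ xr); rewrite /= xs.
congr (_ * _).
  rewrite (eq_bigl (mem s)) ?big_uniq //; by move=> i; rewrite inE.
rewrite -(split_sum_set (fun J K => \prod_(j in J) f (t a) (t j) *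
   rooted_sum (fun i j => f (t i) (t j)) ([set:: s] :|: J) K)) //.
apply: eq_in_split_sum => u w puw.
have uuw : uniq (u ++ w) by rewrite (perm_uniq puw).
have uwr x : (x \in u) || (x \in w) = (x \in r) by rewrite -mem_cat (perm_mem puw).
rewrite (_ : [set:: s] :|: [set:: u] = [set:: s ++ u]); last first.
  by apply/setP => x; rewrite !inE mem_cat.
rewrite IH ?map_cat //.
- move: uuw; rewrite cat_uniq => /and3P[uu _ _]; rewrite big_map.
  by congr (_ * _); rewrite (eq_bigl (mem u)) ?big_uniq //; move=> i; rewrite inE.
- by rewrite size_cat -addnA -(size_cat u) (perm_size puw).
- rewrite -catA cat_uniq us uuw andbT; apply/hasPn => x; rewrite mem_cat uwr.
  exact: sr.
Qed.
End Recursion.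

Lemma psi_cat_psir {d : measure_display} {T : measurableType d} {R : realType}
  (v : T -> T -> \bar R) n k (x : n.-tuple T) (y : k.-tuple T) :
  (forall x y, v x y = v y x) ->
  psi v n (cat_tuple x y) = psir (mayer v) x y.
Proof.
move=> vC; set t := cat_tuple x y.
pose s := map (@lshift n k) (enum 'I_n); pose r := map (@rshift n k) (enum 'I_k).
have -> : tval x = map (tnth t) s.
  rewrite -[LHS]map_tnth_enum /s -map_comp; apply: eq_map => i /=.
  by rewrite tnth_lshift.
have -> : tval y = map (tnth t) r.
  rewrite -[LHS]map_tnth_enum /r -map_comp; apply: eq_map => i /=.
  by rewrite tnth_rshift.
have sE j : (j \in [set:: s]) = (j < n)%N.
  rewrite inE; apply/mapP/idP => [[i _ ->] //=|jn].
  by exists (Ordinal jn); [rewrite mem_enum|apply/val_inj].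
have rE j : (j \in [set:: r]) = (n <= j)%N.
  rewrite inE; apply/mapP/idP => [[i _ ->] /=|jn]; first exact: leq_addr.
  have jk : (j - n < k)%N by rewrite ltn_subLR.
  by exists (Ordinal jk); [rewrite mem_enum|apply/val_inj; rewrite /= subnKC].
rewrite -rooted_sum_psir; last first.
- have us : uniq s by rewrite (map_inj_uniq (@lshift_inj _ _)) enum_uniq.
  have ur : uniq r by rewrite (map_inj_uniq (@rshift_inj _ _)) enum_uniq.
  rewrite cat_uniq us ur andbT /=.
  apply/hasPn => i /mapP[j _ ->]; apply/negP => /mapP[l _ /(congr1 val)/= jl].
  by have := ltn_ord l; rewrite -jl ltnNge leq_addr.
- by move=> a b; rewrite /mayer vC.
apply: eq_bigl => G; rewrite inE /simple_graph /rooted; congr (_ && _).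
  have UE j : j \in [set:: s] :|: [set:: r] by rewrite in_setU sE rE; case: ltnP.
  apply/forallP/fintype.subsetP => [H e eG|H e].
    by rewrite /edges_in in_set !UE !andbT; apply: (implyP (H e)).
  by apply/implyP => /H; rewrite /edges_in in_set => /andP[].
apply: eq_forallb => b; rewrite rE; congr (_ ==> _).
by apply: eq_existsb => a; rewrite sE.
Qed.

End Graphs.

(** * The Boltzmann factor and its convolution with [psir] *)

Section Boltzmann.
Context {T : eqType} {S : comPzRingType} (f : T -> T -> S).
Hypothesis fC : forall x y, f x y = f y x.

Fixpoint boltzr (s : seq T) : S :=
  if s is x :: s' then \prod_(y <- s') (1 + f x y) * boltzr s' else 1.

Lemma boltzr_tuple n (t : n.-tuple T) :
  boltzr t = \prod_(i < n) \prod_(j < n | (i < j)%N) (1 + f (tnth t i) (tnth t j)).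
Proof.
elim: n t => [|n IH] t; first by rewrite tuple0 big_ord0.
case/tupleP: t => x t; rewrite big_ord_recl /= IH; congr (_ * _).
  rewrite [RHS]big_mkcond big_ord_recl /= mul1r big_tuple; apply: eq_bigr => j _.
  by rewrite tnth0 tnthS.
apply: eq_bigr => i _; rewrite [RHS]big_mkcond big_ord_recl /= mul1r [LHS]big_mkcond.
by apply: eq_bigr => j _; rewrite !tnthS.
Qed.

Lemma boltzr_mid s1 x s2 : boltzr (s1 ++ x :: s2) = boltzr (x :: s1 ++ s2).
Proof.
elim: s1 => [//|y s1 IH]; rewrite cat_cons /= IH /= !big_cat /= !big_cons.
by rewrite (fC x y) big_cat /=; ring.
Qed.

Lemma boltzr_perm s1 s2 : perm_eq s1 s2 -> boltzr s1 = boltzr s2.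
Proof.
elim: s1 s2 => [|x s1 IH] s2 ps; first by move: ps; rewrite perm_sym => /perm_nilP ->.
have xs2 : x \in s2 by rewrite -(perm_mem ps) mem_head.
case/splitPr: xs2 ps => s3 s4 ps.
have ps' : perm_eq s1 (s3 ++ s4).
  by rewrite -(perm_cons x) (perm_trans ps) // -cat1s perm_catCA.
rewrite boltzr_mid /= (IH _ ps'); congr (_ * _).
exact: perm_big.
Qed.

Lemma split_sum_nil (K : seq T -> S) s :
  split_sum (fun u w => (nilp u)%:R * K w) s = K s.
Proof.
elim: s K => [|y s IH] K /=; first by rewrite mul1r.
by rewrite IH (split_sumZ 0 (fun _ w => K w)) mul0r add0r.
Qed.

(** Expanding the factors [1 + f x y] over [ys] chooses the neighbours [u] of the first root;
    induction applies to the roots [xs ++ u]. The choice of [u] and the splitting of the rest form a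
    splitting into three, regrouped so that [psir_cons] reassembles [psir] at [x :: xs]. Symmetry of
    [f] serves to move [u] in front of the remaining points. *)
Lemma boltzr_split xs ys :
  boltzr (xs ++ ys) = split_sum (fun u w => psir f xs u * boltzr w) ys.
Proof.
have [k] := ubnP (size xs + size ys)%N.
elim: k xs ys => // k IH [|x xs] ys /=.
  by move=> _; rewrite -[LHS]split_sum_nil; apply: eq_split_sum => u w _; rewrite psir_nil.
rewrite addSn ltnS => sk; rewrite big_cat /= -(split_sum_prod (f x) ys) -mulrA -split_sumMr.
pose H u u' w := \prod_(y <- u) f x y * psir f (xs ++ u) u' * boltzr w.
transitivity (\prod_(x' <- xs) (1 + f x x') *
  split_sum (fun r w => split_sum (fun u u' => H u u' w) r) ys).
  congr (_ * _); rewrite -split_sumA; apply: eq_in_split_sum => u r pur.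
  rewrite /H; under [RHS]eq_split_sum do rewrite -mulrA.
  rewrite split_sumZ -IH; last first.
    by rewrite size_cat -addnA -(size_cat u) (perm_size pur).
  by congr (_ * _); apply: boltzr_perm; rewrite -catA perm_cat2l perm_sym.
rewrite -split_sumZ; apply: eq_split_sum => r w _.
by rewrite psir_cons split_sumMr mulrA.
Qed.

End Boltzmann.

(** * Consequences of repulsion: signs and submultiplicativity *)

Section RepulsiveSigns.
Context {T : eqType} {R : realDomainType} (f : T -> T -> R).
Hypotheses (f_le0 : forall x y, f x y <= 0) (f_geN1 : forall x y, 0 <= 1 + f x y).

Lemma split_sum_ge0 {U : Type} (G : seq U -> seq U -> R) s :
  (forall u w, 0 <= G u w) -> 0 <= split_sum G s.
Proof. by elim: s G => [|y s IH] G G0 //=; rewrite addr_ge0 // IH. Qed.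

Let abs_sum x xs ys := \prod_(x' <- xs) (1 + f x x') *
  split_sum (fun u w => \prod_(y <- u) `|f x y| * `|psir f (xs ++ u) w|) ys.

Let abs_sum_ge0 x xs ys : 0 <= abs_sum x xs ys.
Proof.
rewrite mulr_ge0 ?prodr_ge0 ?split_sum_ge0 // => u w.
by rewrite mulr_ge0 // prodr_ge0.
Qed.

Lemma prod_sign x u : \prod_(y <- u) f x y = (-1) ^+ size u * \prod_(y <- u) `|f x y|.
Proof.
elim: u => [|y u IH]; first by rewrite !big_nil mulr1.
by rewrite !big_cons IH /= exprS ler0_norm //; ring.
Qed.

(** Every term of the recursion has the sign [(-1) ^ (|u| + |w|) = (-1) ^ |ys|], so no cancellation
    occurs and absolute values can be taken termwise. *)
Let psir_cons_sign x xs ys :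
  (forall xs' ys', (size xs' + size ys' = size xs + size ys)%N ->
     psir f xs' ys' = (-1) ^+ size ys' * `|psir f xs' ys'|) ->
  psir f (x :: xs) ys = (-1) ^+ size ys * abs_sum x xs ys.
Proof.
move=> IH; rewrite psir_cons /abs_sum mulrCA; congr (_ * _); rewrite -split_sumZ.
apply: eq_split_sum => u w uw.
by rewrite prod_sign [in LHS]IH ?size_cat -?addnA ?uw // -uw exprD; ring.
Qed.

Let norm_sign n (y : R) : 0 <= y -> `|(-1) ^+ n * y| = y.
Proof. by move=> y0; rewrite normrM normrX normrN1 expr1n mul1r ger0_norm. Qed.

Lemma psir_sign xs ys : psir f xs ys = (-1) ^+ size ys * `|psir f xs ys|.
Proof.
have [k] := ubnP (size xs + size ys)%N; elim: k xs ys => // k IH [|x xs] ys.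
  by move=> _; rewrite psir_nil; case: ys => [|y ys] /=; rewrite ?normr0 ?normr1 ?mulr0 ?mulr1.
rewrite /= addSn ltnS => sk; rewrite psir_cons_sign ?norm_sign //.
by move=> xs' ys' xy; apply: IH; rewrite xy.
Qed.

Lemma norm_psir_cons x xs ys : `|psir f (x :: xs) ys| =
  \prod_(x' <- xs) (1 + f x x') *
  split_sum (fun u w => \prod_(y <- u) `|f x y| * `|psir f (xs ++ u) w|) ys.
Proof.
by rewrite psir_cons_sign ?norm_sign // => *; exact: psir_sign.
Qed.

Lemma boltzr_ge0 s : 0 <= boltzr f s.
Proof. by elim: s => //= x s IH; rewrite mulr_ge0 ?prodr_ge0. Qed.

Lemma prod1f_le1 x s : \prod_(y <- s) (1 + f x y) <= 1.
Proof. by rewrite prodr_ile1 // => y _; rewrite f_geN1 -lerBrDl subrr f_le0. Qed.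

(** The factors [1 + f] between [s] and [r] lie in [[0, 1]] and are dropped. *)
Lemma boltzr_cat_le s r : boltzr f (s ++ r) <= boltzr f s * boltzr f r.
Proof.
elim: s => [|x s IH] /=; first by rewrite mul1r.
rewrite big_cat /= -!mulrA ler_wpM2l ?prodr_ge0 // -[leRHS]mul1r.
by rewrite ler_pM ?prodr_ge0 ?boltzr_ge0 ?prod1f_le1.
Qed.

Lemma boltzr_le1 s : boltzr f s <= 1.
Proof.
elim: s => //= x s IH.
by rewrite mulr_ile1 ?prodr_ge0 ?boltzr_ge0 ?prod1f_le1.
Qed.

End RepulsiveSigns.

Local Open Scope classical_set_scope.
Local Open Scope ring_scope.
Set Implicit Arguments.
Unset Strict Implicit.

(** * Iterated integrals of functions of finite sequences *)

Set Implicit Arguments.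
Unset Strict Implicit.
Section MeasurableSeq.
Context {d : measure_display} {T : measurableType d} {R : realType}.

(* Only sequence-valued maps of constant length are needed, so no sigma-algebra
   on [seq T] is required. *)
Definition mseq {dO} {O : measurableType dO} (h : O -> seq T) : Prop :=
  exists n (h' : O -> n.-tuple T), measurable_fun setT h' /\ h = (fun o => tval (h' o)).

Definition smeas (F : seq T -> \bar R) : Prop :=
  forall n, measurable_fun setT (fun t : n.-tuple T => F t).

Definition mfam {dO} {O : measurableType dO} (H : O -> seq T -> \bar R) : Prop :=
  forall n, measurable_fun setT (fun p : O * n.-tuple T => H p.1 p.2).

Definition smeas2 (G : seq T -> seq T -> \bar R) : Prop :=
  forall m n, measurable_fun setT (fun p : m.-tuple T * n.-tuple T => G p.1 p.2).

Context {dO : measure_display} {O : measurableType dO}.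
Implicit Types (h k : O -> seq T).

Lemma mseq_tval n (h : O -> n.-tuple T) : measurable_fun setT h -> mseq (fun o => tval (h o)).
Proof. by move=> mh; exists n, h. Qed.

Lemma mseq_cst (s : seq T) : mseq (fun _ : O => s).
Proof. by exists (size s), (fun _ => in_tuple s); split => //; exact: measurable_cst. Qed.

Lemma mseq_cons (x : O -> T) h : measurable_fun setT x -> mseq h -> mseq (fun o => x o :: h o).
Proof.
move=> mx [n [h' [mh' ->]]]; exists n.+1, (fun o => cons_tuple (x o) (h' o)).
by split => //; apply: measurable_cons.
Qed.

Lemma mseq_cat h k : mseq h -> mseq k -> mseq (fun o => h o ++ k o).
Proof.
move=> [n [h' [mh' ->]]] [m [k' [mk' ->]]].
exists (n + m)%N, (fun o => cat_tuple (h' o) (k' o)); split => //.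
apply/measurable_fun_tnthP => i.
case: (split_ordP i) => j ->.
  rewrite (_ : _ \o _ = (fun t => tnth t j) \o h'); last first.
    by apply/funext => o /=; rewrite tnth_lshift.
  exact: (measurableT_comp (measurable_tnth j) mh').
rewrite (_ : _ \o _ = (fun t => tnth t j) \o k'); last first.
  by apply/funext => o /=; rewrite tnth_rshift.
exact: (measurableT_comp (measurable_tnth j) mk').
Qed.

Lemma mseq_behead h : mseq h -> mseq (fun o => behead (h o)).
Proof.
move=> [n [h' [mh' ->]]]; case: n h' mh' => [|n] h' mh'.
  rewrite (_ : (fun _ => _) = fun=> [::]); first exact: mseq_cst.
  by apply/funext => o; rewrite (tuple0 (h' o)).
apply: (mseq_tval (h := fun o => [tuple of behead (h' o)])).
exact: (measurableT_comp (@measurable_behead _ _ _) mh').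
Qed.

Lemma mseq_drop i h : mseq h -> mseq (fun o => drop i (h o)).
Proof.
elim: i h => [|i IH] h mh.
  by rewrite (_ : (fun _ => _) = h) //; apply/funext => o; rewrite drop0.
rewrite (_ : (fun _ => _) = fun o => drop i (behead (h o))).
  by apply: IH; exact: mseq_behead.
by apply/funext => o; case: (h o).
Qed.

Lemma mseq_take i h : mseq h -> mseq (fun o => take i (h o)).
Proof.
elim: i h => [|i IH] h mh.
  rewrite (_ : (fun _ => _) = fun=> [::]); first exact: mseq_cst.
  by apply/funext => o; rewrite take0.
case: (mh) => n [h' [mh' hE]]; case: n h' mh' hE => [|n] h' mh' hE.
  rewrite (_ : (fun _ => _) = fun=> [::]); first exact: mseq_cst.
  by apply/funext => o; rewrite hE (tuple0 (h' o)).
rewrite (_ : (fun _ => _) = fun o => tnth (h' o) ord0 :: take i (behead (h o))).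
  apply: mseq_cons; first exact: (measurableT_comp (measurable_tnth ord0) mh').
  by apply: IH; exact: mseq_behead.
by apply/funext => o; rewrite hE {1}(tuple_eta (h' o)).
Qed.

Lemma smeas_comp F h : smeas F -> mseq h -> measurable_fun setT (fun o => F (h o)).
Proof.
move=> mF [n [h' [mh' ->]]]; exact: (measurableT_comp (mF n) mh').
Qed.

Lemma smeas2_comp G h k : smeas2 G -> mseq h -> mseq k ->
  measurable_fun setT (fun o => G (h o) (k o)).
Proof.
move=> mG [n [h' [mh' ->]]] [m [k' [mk' ->]]].
exact: (measurableT_comp (mG n m) (measurable_fun_pair mh' mk')).
Qed.

Lemma mfam_comp {d1} {O1 : measurableType d1} (H : O1 -> seq T -> \bar R) (f : O -> O1) h :
  mfam H -> measurable_fun setT f -> mseq h ->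
  measurable_fun setT (fun o => H (f o) (h o)).
Proof.
move=> mH mf [n [h' [mh' ->]]].
exact: (measurableT_comp (mH n) (measurable_fun_pair mf mh')).
Qed.

End MeasurableSeq.

Section MeasurableSeqTheory.
Context {d : measure_display} {T : measurableType d} {R : realType}.
Implicit Types (F : seq T -> \bar R) (G : seq T -> seq T -> \bar R).

Lemma smeas2r G s : smeas2 G -> smeas (G s).
Proof.
by move=> mG n; apply: smeas2_comp mG _ _; [exact: mseq_cst|exact: mseq_tval].
Qed.

Lemma smeas_cons F : smeas F -> mfam (fun x s => F (x :: s)).
Proof.
move=> mF n; apply: (smeas_comp (h := fun p : T * n.-tuple T => p.1 :: tval p.2) mF).
by apply: mseq_cons => //; exact: mseq_tval.
Qed.

Lemma smeas_cons1 F x : smeas F -> smeas (fun s => F (x :: s)).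
Proof.
move=> mF n; apply: (smeas_comp mF); apply: mseq_cons => //.
exact: mseq_tval.
Qed.

Lemma mfam_smeas2 {dO} {O : measurableType dO} G (h : O -> seq T) :
  smeas2 G -> mseq h -> mfam (fun o => G (h o)).
Proof.
move=> mG [n [h' [mh' ->]]] m.
apply: (smeas2_comp mG); last exact: mseq_tval.
by apply: mseq_tval; apply: measurableT_comp mh' _.
Qed.

Lemma split_sum_ge0e G s : (forall u w, 0 <= G u w)%E -> (0 <= split_sum G s)%E.
Proof. by elim: s G => [|y s IH] G G0 //=; apply: adde_ge0; exact: IH. Qed.

(** The accumulators [a] and [b] hold the entries already distributed; [G] then stays fixed during
    the induction, and only its arguments grow. *)
Lemma measurable_split_sum {dO} {O : measurableType dO} n (c : O -> n.-tuple T)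
    (a b : O -> seq T) G : smeas2 G -> measurable_fun setT c -> mseq a -> mseq b ->
  measurable_fun setT (fun o => split_sum (fun u w => G (a o ++ u) (b o ++ w)) (c o)).
Proof.
move=> mG; elim: n c a b => [|n IH] c a b mc ma mb.
  rewrite (_ : (fun _ => _) = fun o => G (a o) (b o)); first exact: smeas2_comp.
  by apply/funext => o; rewrite tuple0 /= !cats0.
pose x o := tnth (c o) ord0; pose c' o := [tuple of behead (c o)].
have mx : measurable_fun setT x by exact: (measurableT_comp (measurable_tnth ord0) mc).
have mc' : measurable_fun setT c' by exact: (measurableT_comp (@measurable_behead _ _ _) mc).
have mx1 : mseq (fun o => [:: x o]) by apply: mseq_cons => //; exact: mseq_cst.
rewrite (_ : (fun _ => _) = fun o =>
    split_sum (fun u w => G ((a o ++ [:: x o]) ++ u) (b o ++ w)) (c' o) +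
    split_sum (fun u w => G (a o ++ u) ((b o ++ [:: x o]) ++ w)) (c' o))%E.
  apply: emeasurable_funD; apply: IH => //; exact: mseq_cat.
apply/funext => o; rewrite (tuple_eta (c o)) /=.
congr (_ + _)%E; apply: eq_split_sum => u w _; rewrite -catA //.
Qed.

Lemma smeas_split_sum G : smeas2 G -> smeas (split_sum G).
Proof.
move=> mG n; apply: (measurable_split_sum (a := fun=> [::]) (b := fun=> [::]) mG) => //;
exact: mseq_cst.
Qed.

End MeasurableSeqTheory.

Section IteratedIntegral.
Context {d : measure_display} {T : measurableType d} {R : realType}.
Variable mu : {sigma_finite_measure set T -> \bar R}.
Variable w : T -> R.
Hypotheses (mw : measurable_fun setT w) (w_ge0 : forall x, 0 <= w x).
Local Open Scope ereal_scope.
Implicit Types (F : seq T -> \bar R) (G : seq T -> seq T -> \bar R).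

(** Integrands are functions of sequences, so that [cons], [cat], [take] and [drop] can be applied
    to the variables without casts between tuple lengths. *)
Definition sint n F : \bar R := wint mu setT w (fun t : n.-tuple T => F t).

Lemma sintS n F :
  sint n.+1 F = \int[mu]_x ((w x)%:E * sint n (fun s => F (x :: s))).
Proof. by []. Qed.

Lemma eq_sint n F F' : (forall s, size s = n -> F s = F' s) -> sint n F = sint n F'.
Proof.
move=> FF'; rewrite /sint; congr wint; apply/funext => t; apply: FF'.
exact: size_tuple.
Qed.

Let w0 x : 0 <= (w x)%:E. Proof. by rewrite lee_fin. Qed.
Let mEw : measurable_fun setT (fun x => (w x)%:E).
Proof. exact/measurable_EFinP. Qed.
Hint Resolve w0 mEw : core.

Lemma sint_ge0 n F : (forall s, 0 <= F s) -> 0 <= sint n F.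
Proof.
elim: n F => [|n IH] F F0; first exact: F0.
by rewrite sintS; apply: integral_ge0 => x _; rewrite mule_ge0 // IH.
Qed.

(** The parameter space varies in the induction: the outermost variable joins the parameter, and [O]
    is replaced by [O * T]. *)
Lemma measurable_sint {dO} {O : measurableType dO} n (H : O -> seq T -> \bar R) :
  mfam H -> (forall o s, 0 <= H o s) -> measurable_fun setT (fun o => sint n (H o)).
Proof.
elim: n dO O H => [|n IH] dO O H mH H0.
  exact: (mfam_comp mH (@measurable_id _ _ setT) (mseq_cst [::])).
apply: (measurable_fun_fubini_tonelli_F (m2 := mu)
  (fun p : O * T => (w p.2)%:E * sint n (fun s => H p.1 (p.2 :: s)))); last first.
  by move=> p; rewrite mule_ge0 // sint_ge0.
apply: emeasurable_funM; first exact: measurableT_comp mEw _.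
apply: (IH _ _ (fun p s => H p.1 (p.2 :: s))) => // m.
apply: (mfam_comp mH); first by apply: measurableT_comp => //.
apply: mseq_cons; first by apply: measurableT_comp => //.
exact: mseq_tval.
Qed.

Lemma measurable_sint_cons n F : smeas F -> (forall s, 0 <= F s) ->
  measurable_fun setT (fun x => sint n (fun s => F (x :: s))).
Proof. by move=> mF F0; apply: measurable_sint => //; exact: smeas_cons. Qed.

Let m_int n F : smeas F -> (forall s, 0 <= F s) ->
  measurable_fun setT (fun x => (w x)%:E * sint n (fun s => F (x :: s))).
Proof. by move=> mF F0; apply: emeasurable_funM => //; exact: measurable_sint_cons. Qed.

Let int_ge0 n F x : (forall s, 0 <= F s) -> 0 <= (w x)%:E * sint n (fun s => F (x :: s)).
Proof. by move=> F0; rewrite mule_ge0 // sint_ge0. Qed.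

Lemma smeas_sint n G : smeas2 G -> (forall u s, 0 <= G u s) -> smeas (fun u => sint n (G u)).
Proof.
move=> mG G0 m; apply: measurable_sint => //; apply: mfam_smeas2 => //.
exact: mseq_tval.
Qed.

(** The exceptional points are removed one coordinate at a time, each time from a single integral
    over [mu]; no product null set appears. *)
Lemma ae_le_sint (good : set T) n F F' : measurable good -> mu (~` good) = 0 ->
  smeas F -> smeas F' -> (forall s, 0 <= F s) -> (forall s, 0 <= F' s) ->
  (forall s, size s = n -> (forall x, x \in s -> good x) -> F s <= F' s) ->
  sint n F <= sint n F'.
Proof.
move=> mg mu0; elim: n F F' => [|n IH] F F' mF mF' F0 F'0 FF'.
  by apply: FF' => // x; rewrite inE.
rewrite !sintS; apply: ae_ge0_le_integral => //.
- by move=> x _; exact: int_ge0.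
- exact: m_int.
- by move=> x _; exact: int_ge0.
- exact: m_int.
exists (~` good); split => //; first exact: measurableC.
apply: subsetC => x gx _; rewrite lee_wpmul2l //; apply: IH => //.
- exact: smeas_cons1.
- exact: smeas_cons1.
move=> s sn gs; apply: FF'; first by rewrite /= sn.
by move=> y; rewrite inE => /orP[/eqP ->//|/gs].
Qed.

Lemma le_sint n F F' : smeas F -> smeas F' ->
  (forall s, 0 <= F s) -> (forall s, 0 <= F' s) ->
  (forall s, size s = n -> F s <= F' s) -> sint n F <= sint n F'.
Proof.
move=> mF mF' F0 F'0 FF'; apply: (@ae_le_sint setT) => //.
  by rewrite setCT measure0.
by move=> s sn _; exact: FF'.
Qed.

Lemma sintD n F F' : smeas F -> smeas F' ->
  (forall s, 0 <= F s) -> (forall s, 0 <= F' s) ->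
  sint n (fun s => F s + F' s) = sint n F + sint n F'.
Proof.
elim: n F F' => // n IH F F' mF mF' F0 F'0; rewrite !sintS -ge0_integralD //.
- apply: eq_integral => x _; rewrite IH //; try exact: smeas_cons1.
  by rewrite ge0_muleDr // sint_ge0.
- by move=> x _; exact: int_ge0.
- exact: m_int.
- by move=> x _; exact: int_ge0.
- exact: m_int.
Qed.

Lemma sintZ n F c : smeas F -> (forall s, 0 <= F s) -> 0 <= c ->
  sint n (fun s => c * F s) = c * sint n F.
Proof.
move=> mF F0 c0; elim: n F mF F0 => // n IH F mF F0; rewrite !sintS -ge0_integralZl //.
- by apply: eq_integral => x _; rewrite IH //; [rewrite muleCA|exact: smeas_cons1].
- exact: m_int.
- by move=> x _; exact: int_ge0.
Qed.

Lemma sint0 n : sint n (fun=> 0) = 0.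
Proof.
elim: n => // n IH; rewrite sintS; under eq_integral do rewrite IH mule0.
exact: integral0.
Qed.

Lemma smeasD F F' : smeas F -> smeas F' -> smeas (fun s => F s + F' s).
Proof. by move=> mF mF' n; apply: emeasurable_funD; [exact: mF|exact: mF']. Qed.

Lemma smeasM F F' : smeas F -> smeas F' -> smeas (fun s => F s * F' s).
Proof. by move=> mF mF' n; apply: emeasurable_funM; [exact: mF|exact: mF']. Qed.

Lemma smeas_cst c : smeas (fun _ : seq T => c : \bar R).
Proof. by move=> n; exact: measurable_cst. Qed.

Lemma smeas_sum {I : Type} (r : seq I) (F : I -> seq T -> \bar R) :
  (forall i, smeas (F i)) -> smeas (fun s => \sum_(i <- r) F i s).
Proof. by move=> mF n; apply: emeasurable_sum => i; exact: mF. Qed.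

Lemma sint_sum {I : Type} (r : seq I) n (F : I -> seq T -> \bar R) :
  (forall i, smeas (F i)) -> (forall i s, 0 <= F i s) ->
  sint n (fun s => \sum_(i <- r) F i s) = \sum_(i <- r) sint n (F i).
Proof.
move=> mF F0; elim: r => [|i r IH].
  by rewrite big_nil -[RHS](sint0 n); apply: eq_sint => s _; rewrite big_nil.
rewrite big_cons -IH -sintD //.
- by apply: eq_sint => s _; rewrite big_cons.
- exact: smeas_sum.
- by move=> s; exact: sume_ge0.
Qed.

Lemma smeas_nneseries (F : nat -> seq T -> \bar R) :
  (forall i, smeas (F i)) -> (forall i s, 0 <= F i s) ->
  smeas (fun s => \sum_(i <oo) F i s).
Proof.
move=> mF F0 n; apply: (ge0_emeasurable_sum (P := xpredT)) => // k _; exact: mF.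
Qed.

Lemma sint_nneseries n (F : nat -> seq T -> \bar R) :
  (forall i, smeas (F i)) -> (forall i s, 0 <= F i s) ->
  sint n (fun s => \sum_(i <oo) F i s) = \sum_(i <oo) sint n (F i).
Proof.
elim: n F => // n IH F mF F0; rewrite sintS.
transitivity (\int[mu]_x \sum_(i <oo) ((w x)%:E * sint n (fun s => F i (x :: s)))).
  apply: eq_integral => x _; rewrite IH //; last by move=> i; exact: smeas_cons1.
  by rewrite nneseriesZl // => i _; exact: sint_ge0.
rewrite integral_nneseries //; first by move=> i; exact: m_int.
by move=> i x _; exact: int_ge0.
Qed.

Lemma weighted_tonelli (h : T * T -> \bar R) :
  measurable_fun setT h -> (forall p, 0 <= h p) ->
  \int[mu]_x ((w x)%:E * \int[mu]_y ((w y)%:E * h (x, y))) =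
  \int[mu]_y ((w y)%:E * \int[mu]_x ((w x)%:E * h (x, y))).
Proof.
move=> mh h0; pose f (p : T * T) := (w p.1)%:E * ((w p.2)%:E * h p).
have mf : measurable_fun setT f.
  apply: emeasurable_funM; first exact: measurableT_comp mEw _.
  by apply: emeasurable_funM => //; exact: measurableT_comp mEw _.
have f0 p : 0 <= f p by rewrite /f !mule_ge0.
transitivity (\int[mu]_x \int[mu]_y f (x, y)).
  apply: eq_integral => x _; rewrite -ge0_integralZl //.
    apply: emeasurable_funM => //.
    exact: (measurableT_comp mh (measurable_pair1 x)).
  by move=> y _; rewrite mule_ge0.
rewrite (fubini_tonelli f) //; apply: eq_integral => y _.
rewrite -ge0_integralZl //.
- by apply: eq_integral => x _; rewrite /f /= muleCA.
- apply: emeasurable_funM => //.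
  exact: (measurableT_comp mh (measurable_pair2 y)).
- by move=> x _; rewrite mule_ge0.
Qed.

Lemma sint_swap n (H : T -> seq T -> \bar R) : mfam H -> (forall x s, 0 <= H x s) ->
  \int[mu]_x ((w x)%:E * sint n (H x)) =
  sint n (fun s => \int[mu]_x ((w x)%:E * H x s)).
Proof.
elim: n H => // n IH H mH H0; rewrite sintS.
rewrite (weighted_tonelli (h := fun p => sint n (fun s => H p.1 (p.2 :: s)))); last 2 first.
- apply: measurable_sint => // m.
  apply: (mfam_comp mH); first by apply: measurableT_comp => //.
  apply: mseq_cons; first by apply: measurableT_comp => //.
  exact: mseq_tval.
- by move=> p; exact: sint_ge0.
apply: eq_integral => y _; rewrite -IH // => m.
apply: (mfam_comp mH) => //; apply: mseq_cons => //; exact: mseq_tval.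
Qed.

(** Tonelli: any coordinate can be made the outermost one. Induction on [i] exchanges it with the
    coordinates in front of it. *)
Lemma sint_insert n i F : (i <= n)%N -> smeas F -> (forall s, 0 <= F s) ->
  sint n.+1 F =
  \int[mu]_x ((w x)%:E * sint n (fun s => F (take i s ++ x :: drop i s))).
Proof.
have base m F' : sint m.+1 F' =
    \int[mu]_x ((w x)%:E * sint m (fun s => F' (take 0 s ++ x :: drop 0 s))).
  rewrite sintS; apply: eq_integral => x _; congr (_ * _).
  by apply: eq_sint => s _; rewrite take0 drop0.
elim: n i F => [|n IH] [|i] F // ni mF F0.
- rewrite sintS; transitivity (\int[mu]_y ((w y)%:E *
      \int[mu]_x ((w x)%:E * sint n (fun s => F (y :: take i s ++ x :: drop i s))))).
    by apply: eq_integral => y _; rewrite (IH i) //; exact: smeas_cons1.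
  rewrite (weighted_tonelli (h := fun p =>
     sint n (fun s => F (p.1 :: take i s ++ p.2 :: drop i s)))) //.
  + apply: measurable_sint => // m.
    apply: (smeas_comp mF); apply: mseq_cons; first exact: measurableT_comp.
    apply: mseq_cat; last apply: mseq_cons.
    * by apply: mseq_take; exact: mseq_tval.
    * exact: measurableT_comp.
    * by apply: mseq_drop; exact: mseq_tval.
  + by move=> p; exact: sint_ge0.
Qed.

(** Pascal's rule in the form produced by a splitting: the head of the sequence enlarges either the
    first part or the second. *)
Lemma pascal_sum (A : nat -> nat -> \bar R) k : (forall i j, 0 <= A i j) ->
  \sum_(i < k.+1) 'C(k, i)%:R%:E * A i.+1 (k - i)%N +
  \sum_(i < k.+1) 'C(k, i)%:R%:E * A i (k - i).+1 =
  \sum_(i < k.+2) 'C(k.+1, i)%:R%:E * A i (k.+1 - i)%N.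
Proof.
move=> A0; rewrite [RHS]big_ord_recl /= bin0 subn0.
under [X in _ = _ + X]eq_bigr => i _.
  rewrite /bump /= add1n subSS binS natrD EFinD ge0_muleDl ?lee_fin //; over.
rewrite big_split /= addeA [RHS]addeC; congr (_ + _).
rewrite big_ord_recl bin0 subn0; congr (_ + _).
rewrite [RHS]big_ord_recr /= bin_small // mul0e adde0.
by apply: eq_bigr => i _; rewrite /bump /= add1n subnSK.
Qed.

(** All splittings with [|u| = i] have the same integral. In the induction the head is the outermost
    variable; it is already in place when it belongs to [u], and must be moved past the variables of
    [u] otherwise. *)
Lemma sint_split_sum k G : smeas2 G -> (forall u s, 0 <= G u s) ->
  sint k (split_sum G) =
  \sum_(i < k.+1) 'C(k, i)%:R%:E * sint i (fun u => sint (k - i)%N (G u)).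
Proof.
elim: k G => [|k IH] G mG G0; first by rewrite big_ord1 bin0 mul1e.
pose A i j := sint i (fun u => sint j (G u)).
have A0 i j : 0 <= A i j by apply: sint_ge0 => u; exact: sint_ge0.
have mGl y : smeas2 (fun u s => G (y :: u) s).
  move=> m n; apply: (smeas2_comp mG); last by apply: mseq_tval.
  by apply: mseq_cons => //; exact: mseq_tval.
have mGr y : smeas2 (fun u s => G u (y :: s)).
  move=> m n; apply: (smeas2_comp mG); first by apply: mseq_tval.
  by apply: mseq_cons => //; exact: mseq_tval.
apply: etrans (pascal_sum k A0).
have msl (H : T -> seq T -> seq T -> \bar R) (i j : nat) :
    (forall m n, measurable_fun setT
       (fun p : T * m.-tuple T * n.-tuple T => H p.1.1 p.1.2 p.2)) ->
    (forall y u s, 0 <= H y u s) ->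
    mfam (fun y u => sint j (H y u)).
  move=> mH H0 m; apply: (@measurable_sint _ (T * m.-tuple T)%type j (fun p => H p.1 (tval p.2))) => // n.
  exact: mH.
have mHl m n : measurable_fun setT
    (fun p : T * m.-tuple T * n.-tuple T => G (p.1.1 :: tval p.1.2) p.2).
  apply: (smeas2_comp (h := fun p : T * m.-tuple T * n.-tuple T => p.1.1 :: tval p.1.2)
    (k := fun p : T * m.-tuple T * n.-tuple T => tval p.2) mG).
    by apply: mseq_cons; [|apply: mseq_tval]; exact: measurableT_comp.
  exact: mseq_tval.
have mHr m n : measurable_fun setT
    (fun p : T * m.-tuple T * n.-tuple T => G p.1.2 (p.1.1 :: tval p.2)).
  apply: (smeas2_comp (h := fun p : T * m.-tuple T * n.-tuple T => tval p.1.2)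
    (k := fun p : T * m.-tuple T * n.-tuple T => p.1.1 :: tval p.2) mG).
    by apply: mseq_tval; exact: measurableT_comp.
  by apply: mseq_cons; [exact: measurableT_comp|exact: mseq_tval].
pose al i y := sint i (fun u => sint (k - i)%N (G (y :: u))).
pose ar i y := sint i (fun u => sint (k - i)%N (fun s => G u (y :: s))).
have mal i : measurable_fun setT (al i).
  apply: measurable_sint; last by move=> y u; exact: sint_ge0.
  exact: (msl (fun y u s => G (y :: u) s) i).
have mar i : measurable_fun setT (ar i).
  apply: measurable_sint; last by move=> y u; exact: sint_ge0.
  exact: (msl (fun y u s => G u (y :: s)) i).
have al0 i y : 0 <= al i y by apply: sint_ge0 => u; exact: sint_ge0.
have ar0 i y : 0 <= ar i y by apply: sint_ge0 => u; exact: sint_ge0.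
have comb (b : nat -> T -> \bar R) : (forall i, measurable_fun setT (b i)) ->
    (forall i y, 0 <= b i y) ->
    \int[mu]_y ((w y)%:E * \sum_(i < k.+1) 'C(k, i)%:R%:E * b i y) =
    \sum_(i < k.+1) 'C(k, i)%:R%:E * \int[mu]_y ((w y)%:E * b i y).
  move=> mb b0; transitivity (\int[mu]_y
      \sum_(i < k.+1) 'C(k, i)%:R%:E * ((w y)%:E * b i y)).
    apply: eq_integral => y _; rewrite ge0_sume_distrr.
      by apply: eq_bigr => i _; rewrite muleCA.
    by move=> i _; rewrite mule_ge0.
  rewrite ge0_integral_sum //.
  - apply: eq_bigr => i _; rewrite ge0_integralZl //; first exact: emeasurable_funM.
    by move=> y _; rewrite mule_ge0.
  - by move=> i; apply: emeasurable_funM => //; exact: emeasurable_funM.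
  - by move=> i y _; rewrite !mule_ge0.
have S0 (b : nat -> T -> \bar R) y : (forall i y, 0 <= b i y) ->
    0 <= \sum_(i < k.+1) 'C(k, i)%:R%:E * b i y.
  by move=> b0; apply: sume_ge0 => i _; rewrite mule_ge0.
have mS (b : nat -> T -> \bar R) : (forall i, measurable_fun setT (b i)) ->
    measurable_fun setT (fun y => (w y)%:E * \sum_(i < k.+1) 'C(k, i)%:R%:E * b i y).
  move=> mb; apply: emeasurable_funM => //; apply: emeasurable_sum => i.
  exact: emeasurable_funM.
transitivity (\int[mu]_y ((w y)%:E * \sum_(i < k.+1) 'C(k, i)%:R%:E * al i y) +
              \int[mu]_y ((w y)%:E * \sum_(i < k.+1) 'C(k, i)%:R%:E * ar i y)).
  rewrite sintS -ge0_integralD //.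
  - apply: eq_integral => y _; rewrite -ge0_muleDr ?S0 //; congr (_ * _).
    rewrite -(IH (fun u => G (y :: u))) // -(IH (fun u s => G u (y :: s))) //.
    by rewrite -sintD //; [exact: smeas_split_sum|exact: smeas_split_sum|
       move=> s; exact: split_sum_ge0e|move=> s; exact: split_sum_ge0e].
  - by move=> y _; rewrite mule_ge0 ?S0.
  - exact: mS.
  - by move=> y _; rewrite mule_ge0 ?S0.
  - exact: mS.
rewrite !comb //; congr (_ + _); apply: eq_bigr => i _; congr (_ * _).
(* The head [y] belongs to the second part, so its integral is carried inside those over [u]. *)
rewrite /ar sint_swap //; first exact: (msl (fun y u s => G u (y :: s)) i).
by move=> y u; exact: sint_ge0.
Qed.

Lemma sint_split_sum_fact k G : smeas2 G -> (forall u s, 0 <= G u s) ->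
  (k`!%:R^-1)%:E * sint k (split_sum G) =
  \sum_(i < k.+1) (i`!%:R^-1)%:E *
     sint i (fun u => ((k - i)`!%:R^-1)%:E * sint (k - i)%N (G u)).
Proof.
move=> mG G0; rewrite sint_split_sum // ge0_sume_distrr; last first.
  by move=> i _; rewrite mule_ge0 // sint_ge0 // => u; exact: sint_ge0.
apply: eq_bigr => i _; rewrite sintZ //; last 2 first.
- exact: smeas_sint.
- by move=> u; exact: sint_ge0.
rewrite !muleA; congr (_ * _); rewrite -!EFinM; congr EFin.
have ik : (i <= k)%N by rewrite -ltnS.
have fnz m : (m`!%:R : R) != 0%R by rewrite pnatr_eq0 -lt0n fact_gt0.
by rewrite -(bin_fact ik) !natrM; field; rewrite !fnz pnatr_eq0 -lt0n bin_gt0.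
Qed.

(** If the integral of a nonnegative function vanishes, then for almost every first coordinate the
    weight or the inner integral vanishes; the induction hypothesis applies in the second case. *)
Lemma sint_eq0 n F F' : smeas F -> smeas F' ->
  (forall s, 0 <= F s) -> (forall s, 0 <= F' s) ->
  (forall s, size s = n -> F s = 0 -> F' s = 0) -> sint n F = 0 -> sint n F' = 0.
Proof.
elim: n F F' => [|n IH] F F' mF mF' F0 F'0 FF'; first exact: FF'.
have int_abs K : (forall s, 0 <= K s) -> sint n.+1 K =
    \int[mu]_x `|(w x)%:E * sint n (fun s => K (x :: s))|.
  by move=> K0; rewrite sintS; apply: eq_integral => x _; rewrite gee0_abs // int_ge0.
rewrite !int_abs // => /(ae_eq_integral_abs mu measurableT (m_int n mF F0)).1 ae0.
apply/(ae_eq_integral_abs mu measurableT (m_int n mF' F'0)).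
apply: filterS ae0 => x /(_ I) /eqP; rewrite mule_eq0 => /orP[/eqP wx0|/eqP sx0] _.
  by rewrite wx0 mul0e.
rewrite (IH (fun s => F (x :: s))) ?mule0 //; try exact: smeas_cons1.
by move=> s sn; apply: FF'; rewrite /= sn.
Qed.

End IteratedIntegral.

Lemma smeas_prod {d : measure_display} {T : measurableType d} {R : realType} (g : T -> R) :
  measurable_fun setT g -> smeas (fun s => (\prod_(y <- s) g y)%:E).
Proof.
move=> mg n; apply/measurable_EFinP.
rewrite (_ : (fun _ => _) = fun t : n.-tuple T => \prod_(i <- enum 'I_n) g (tnth t i)).
  by apply: measurable_prod => i _; exact: (measurableT_comp mg (measurable_tnth i)).
by apply/funext => t; rewrite big_tuple big_enum.
Qed.

(** Trades the domain for a weight, so that finite-volume integrals become integrals over the whole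
    space. *)
Lemma wint_mkcond {d : measure_display} {T : measurableType d} {R : realType}
  (mu : {measure set T -> \bar R}) (D : set T) (w : T -> R) n (F : n.-tuple T -> \bar R) :
  wint mu D w F = wint mu setT (fun x => w x * \1_D x) F.
Proof.
elim: n F => //= n IH F; rewrite integral_mkcond; apply: eq_integral => x _.
rewrite /patch indicE; case: ifP => xD /=; last by rewrite mulr0 mul0e.
by rewrite mulr1 IH.
Qed.

Section TupleFunctions.
Context {d : measure_display} {T : measurableType d} {R : realType} (n : nat).
Implicit Type F : n.-tuple T -> \bar R.
Local Open Scope ereal_scope.

Definition seqext F (s : seq T) : \bar R := oapp F 0 (insub s).

Lemma seqextE F (t : n.-tuple T) : seqext F t = F t.
Proof. by rewrite /seqext valK. Qed.

Lemma seqext_ge0 F s : (forall t, 0 <= F t) -> 0 <= seqext F s.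
Proof. by rewrite /seqext; case: insub => //=. Qed.

Lemma smeas_seqext F : measurable_fun setT F -> smeas (seqext F).
Proof.
move=> mF m; have [->|mn] := eqVneq m n.
  by rewrite (_ : (fun _ => _) = F) //; apply/funext => t; exact: seqextE.
rewrite (_ : (fun _ => _) = cst 0); first exact: measurable_cst.
by apply/funext => t; rewrite /seqext insubF //= size_tuple; exact/negbTE.
Qed.

Lemma sint_seqext (mu : {sigma_finite_measure set T -> \bar R}) (w : T -> R) F :
  sint mu w n (seqext F) = wint mu setT w F.
Proof. by rewrite /sint; congr wint; apply/funext => t; exact: seqextE. Qed.

End TupleFunctions.

Section Weights.
Context {d : measure_display} {T : measurableType d} {R : realType}.
Variable mu : {sigma_finite_measure set T -> \bar R}.
Variable w : T -> R.
Hypotheses (mw : measurable_fun setT w) (w_ge0 : forall x, 0 <= w x).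
Local Open Scope ereal_scope.

Lemma sint_weight n (F : seq T -> \bar R) : smeas F -> (forall s, 0 <= F s) ->
  sint mu w n F = sint mu (fun=> 1%R) n (fun s => (\prod_(y <- s) w y)%:E * F s).
Proof.
elim: n F => [|n IH] F mF F0; first by rewrite /sint /= big_nil mul1e.
rewrite !sintS; apply: eq_integral => x _.
rewrite mul1e IH //; last exact: smeas_cons1.
rewrite -sintZ //; last 3 first.
- by apply: smeasM; [exact: smeas_prod|exact: smeas_cons1].
- by move=> s; rewrite mule_ge0 // lee_fin prodr_ge0.
- by rewrite lee_fin.
by apply: eq_sint => s _; rewrite big_cons EFinM muleA.
Qed.

Lemma mseq_nth {dO} {O : measurableType dO} x0 (h : O -> seq T) (r : seq nat) :
  mseq h -> mseq (fun o => map (nth x0 (h o)) r).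
Proof.
move=> [n [h' [mh' ->]]]; elim: r => [|i r IH] /=; first exact: mseq_cst.
apply: mseq_cons => //; case: (ltnP i n) => ni.
  rewrite (_ : (fun _ => _) = fun o => tnth (h' o) (Ordinal ni)).
    exact: (measurableT_comp (measurable_tnth _) mh').
  by apply/funext => o; rewrite (tnth_nth x0).
rewrite (_ : (fun _ => _) = cst x0); first exact: measurable_cst.
by apply/funext => o; rewrite nth_default // size_tuple.
Qed.

(** The coordinates listed in [r] are pulled to the front one by one with [sint_insert]. This
    permutes the arguments of [E], which must be symmetric, but keeps the order in which [g]
    receives its own. *)
Lemma sint_select x0 (r : seq nat) m (g E : seq T -> \bar R) :
  uniq r -> all (gtn m) r -> smeas g -> smeas E ->
  (forall s, 0 <= g s) -> (forall s, 0 <= E s) ->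
  (forall s t, perm_eq s t -> E s = E t) ->
  sint mu w m (fun y => g (map (nth x0 y) r) * E y) =
  sint mu w (size r) (fun u => g u * sint mu w (m - size r)%N (fun s => E (u ++ s))).
Proof.
move: {2}(size r) (erefl (size r)) => k; elim: k r m g E => [|k IH] [|i r] m g E //.
  by move=> _ _ _ mg mE g0 E0 _; rewrite subn0 /= [RHS]/sint /= -sintZ.
move=> [rk]; case: m => [//|m] /andP[ir ur] /andP[im rm] mg mE g0 E0 pE.
rewrite (@sint_insert _ _ _ mu w mw w_ge0 m i) //; last 2 first.
- by move=> n; apply: emeasurable_funM; [apply: (smeas_comp mg);
    apply: mseq_nth; exact: mseq_tval|exact: mE].
- by move=> s; rewrite mule_ge0.
rewrite sintS; apply: eq_integral => x _; congr (_ * _).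
(* With coordinate [i] removed, the positions behind it move down by one; [unbump i] renumbers
   them. *)
have nr j : j \in r -> j != i by apply: contraTneq => ->.
have injr : {in r &, injective (unbump i)}.
  by move=> a b /nr ai /nr bi; apply: (can_in_inj (@unbumpK i)); rewrite inE.
have ur' : uniq (map (unbump i) r) by rewrite map_inj_in_uniq.
have rm' : all (gtn m) (map (unbump i) r).
  apply/allP => _ /mapP[j jr ->] /=; move/allP: rm => /(_ _ jr) /=.
  by move: (nr _ jr) im; rewrite /unbump /=; lia.
have pEx s t : perm_eq s t -> E (x :: s) = E (x :: t).
  by move=> st; apply: pE; rewrite perm_cons.
have := IH (map (unbump i) r) m (fun u => g (x :: u)) (fun u => E (x :: u)).
rewrite size_map => /(_ rk ur' rm' (smeas_cons1 _ mg) (smeas_cons1 _ mE)) <- //.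
apply: eq_sint => y ym /=; congr (_ * _); last first.
  by apply: pE; rewrite -cat1s perm_catCA /= cat_take_drop perm_refl.
have iy : (i <= size y)%N by rewrite ym -ltnS.
congr (g (_ :: _)); first by rewrite nth_cat size_takel // ltnn subnn.
rewrite -map_comp; apply/eq_in_map => j jr /=.
rewrite nth_cat size_takel // /unbump; case: (ltngtP j i) (nr _ jr) => // ji _.
  by rewrite subn0 nth_take.
have -> : (j - i = (j - i.+1).+1)%N by lia.
by rewrite /= nth_drop; congr nth; lia.
Qed.

End Weights.

(** * The convergence bound *)

Lemma triangle_sum {M : nmodType} (b : nat -> nat -> M) K :
  \sum_(k < K.+1) \sum_(i < k.+1) b i (k - i)%N =
  \sum_(i < K.+1) \sum_(j < (K - i).+1) b i j.
Proof.
elim: K => [|K IH]; first by rewrite !big_ord1.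
rewrite big_ord_recr IH [RHS]big_ord_recr /= subnn big_ord1 [X in _ + X]big_ord_recr /= subnn.
rewrite addrA; congr (_ + _); rewrite -big_split; apply: eq_bigr => i _ /=.
by rewrite subSn ?[RHS]big_ord_recr // -ltnS.
Qed.

Lemma EFin_split_sum {T : Type} {R : realType} (G : seq T -> seq T -> R) s :
  (split_sum G s)%:E = split_sum (fun u w => (G u w)%:E) s.
Proof. by elim: s G => [//|y s IH] G /=; rewrite EFinD !IH. Qed.

Lemma sint_le_weight {d : measure_display} {T : measurableType d} {R : realType}
  (mu : {sigma_finite_measure set T -> \bar R}) (w w' : T -> R) n (F : seq T -> \bar R) :
  measurable_fun setT w -> measurable_fun setT w' ->
  (forall x, 0 <= w x) -> (forall x, w x <= w' x) ->
  smeas F -> (forall s, 0 <= F s)%E -> (sint mu w n F <= sint mu w' n F)%E.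
Proof.
move=> mw mw' w0 ww'; have w'0 x : 0 <= w' x by exact: le_trans (ww' x).
elim: n F => [//|n IH] F mF F0; rewrite !sintS; apply: ge0_le_integral => //.
- by move=> x _; rewrite mule_ge0 ?lee_fin // sint_ge0.
- by apply: emeasurable_funM; [exact/measurable_EFinP|exact: measurable_sint_cons].
- by apply: emeasurable_funM; [exact/measurable_EFinP|exact: measurable_sint_cons].
- move=> x _; apply: lee_pmul; rewrite ?lee_fin ?sint_ge0 //.
  by apply: IH => //; exact: smeas_cons1.
Qed.

Section ConvergenceBound.
Context {d : measure_display} {T : measurableType d} {R : realType}.
Variables (mu : {sigma_finite_measure set T -> \bar R}) (f : T -> T -> R) (z a : T -> R).
Hypotheses (f_le0 : forall x y, f x y <= 0) (f_geN1 : forall x y, 0 <= 1 + f x y).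
Hypothesis mf : measurable_fun setT (fun p : T * T => f p.1 p.2).
Hypothesis mpsi : smeas2 (fun xs ys => (psir f xs ys)%:E).
Hypothesis mboltz : smeas (fun s => (boltzr f s)%:E).
Hypotheses (mz : measurable_fun setT z) (z_ge0 : forall x, 0 <= z x).
Hypothesis ma : measurable_fun setT a.
Local Open Scope ereal_scope.

Let P xs ys : \bar R := `|psir f xs ys|%:E.

Let P0 xs ys : 0 <= P xs ys. Proof. by rewrite lee_fin. Qed.

Lemma smeas2_norm_psir : smeas2 P.
Proof.
move=> m n; have /measurable_EFinP h := @mpsi m n; apply/measurable_EFinP.
exact: measurableT_comp h.
Qed.
Let mP := smeas2_norm_psir.

Let mPcat xs : smeas2 (fun u s => P (xs ++ u) s).
Proof.
move=> m n; apply: (smeas2_comp mP); last exact: mseq_tval.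
by apply: mseq_cat; [exact: mseq_cst|exact: mseq_tval].
Qed.

Definition psi_int k xs : \bar R := (k`!%:R^-1)%:E * sint mu z k (P xs).

Lemma psi_int_ge0 k xs : 0 <= psi_int k xs.
Proof. by rewrite mule_ge0 // sint_ge0. Qed.

Lemma smeas_psi_int k xs : smeas (fun u => psi_int k (xs ++ u)).
Proof.
rewrite /psi_int; apply: smeasM; first exact: smeas_cst.
by apply: (smeas_sint mu mz z_ge0 k (mPcat xs)).
Qed.

Lemma measurable_f1 x : measurable_fun setT (f x).
Proof. exact: (measurableT_comp mf (measurable_pair1 x)). Qed.

Lemma smeas_prod_norm x : smeas (fun u => (\prod_(y <- u) `|f x y|)%:E).
Proof.
by apply: smeas_prod; apply: measurableT_comp => //; exact: measurable_f1.
Qed.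

(** The recursion integrated over the [k] added vertices, where [i] counts those joined to [x]; the
    factorial [(k - i)!] is absorbed by [psi_int (k - i)]. *)
Lemma psi_int_cons k x xs : psi_int k (x :: xs) =
  (\prod_(x' <- xs) (1 + f x x'))%R%:E * \sum_(i < k.+1) (i`!%:R^-1)%:E *
    sint mu z i (fun u => (\prod_(y <- u) `|f x y|)%:E * psi_int (k - i) (xs ++ u)).
Proof.
pose G u w := (\prod_(y <- u) `|f x y|)%:E * P (xs ++ u) w.
have mG : smeas2 G.
  move=> m n; apply: emeasurable_funM; last exact: mPcat.
  by apply: (smeas_comp (smeas_prod_norm x)); exact: mseq_tval.
have G0 u w : 0 <= G u w by rewrite mule_ge0 // lee_fin prodr_ge0.
rewrite /psi_int (@eq_sint _ _ _ mu z k _ (fun ys =>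
    (\prod_(x' <- xs) (1 + f x x'))%R%:E * split_sum G ys)); last first.
  by move=> ys _; rewrite /P norm_psir_cons // EFinM EFin_split_sum; congr (_ * _).
rewrite sintZ //; last 3 first.
- exact: smeas_split_sum.
- by move=> s; exact: split_sum_ge0e.
- by rewrite lee_fin prodr_ge0.
rewrite muleCA sint_split_sum_fact //; congr (_ * _).
apply: eq_bigr => i _; congr (_ * _); apply: eq_sint => u _.
rewrite /G sintZ ?lee_fin ?prodr_ge0 //; last exact: smeas2r (mPcat _).
by rewrite muleCA.
Qed.

Definition psi_trunc K xs := \sum_(k < K.+1) psi_int k xs.

(** The pairs formed by [i] new roots and [j] remaining vertices fill the triangle [i + j <= K], so
    a fixed [i] leaves the truncation [K - i]. *)
Lemma psi_trunc_cons K x xs : psi_trunc K (x :: xs) =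
  (\prod_(x' <- xs) (1 + f x x'))%R%:E * \sum_(i < K.+1) (i`!%:R^-1)%:E *
    sint mu z i (fun u => (\prod_(y <- u) `|f x y|)%:E * psi_trunc (K - i) (xs ++ u)).
Proof.
pose b i j := (i`!%:R^-1)%:E *
    sint mu z i (fun u => (\prod_(y <- u) `|f x y|)%:E * psi_int j (xs ++ u)).
have mb j : smeas (fun u => (\prod_(y <- u) `|f x y|)%:E * psi_int j (xs ++ u)).
  by apply: smeasM; [exact: smeas_prod_norm|exact: smeas_psi_int].
have b00 j u : 0 <= (\prod_(y <- u) `|f x y|)%:E * psi_int j (xs ++ u).
  by rewrite mule_ge0 ?psi_int_ge0 // lee_fin prodr_ge0.
have b0 i j : 0 <= b i j by rewrite mule_ge0 // sint_ge0.
rewrite /psi_trunc; under [LHS]eq_bigr do rewrite psi_int_cons.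
rewrite -ge0_sume_distrr; last by move=> k _; apply: sume_ge0 => i _; exact: b0.
congr (_ * _); rewrite (triangle_sum b); apply: eq_bigr => i _.
rewrite -ge0_sume_distrr; last by move=> j _; exact: sint_ge0.
congr (_ * _); rewrite -sint_sum //; apply: eq_sint => u _.
by rewrite ge0_sume_distrr // => k _; exact: psi_int_ge0.
Qed.

(** The integrand of the convergence condition at the root [x], with the factors [z] left to the
    weight of the integral. *)
Definition ks_weight x (y : seq T) : \bar R :=
  (\prod_(t <- y) `|f x t| * boltzr f y * \prod_(t <- y) expR (a t))%R%:E.

Lemma ks_weight_ge0 x y : 0 <= ks_weight x y.
Proof.
rewrite lee_fin !mulr_ge0 ?prodr_ge0 // => *; rewrite ?expR_ge0 //.
exact: boltzr_ge0.
Qed.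

Lemma smeas_ks_weight x : smeas (ks_weight x).
Proof.
rewrite (_ : ks_weight x = fun y => (\prod_(t <- y) `|f x t|)%:E *
    (boltzr f y)%:E * (\prod_(t <- y) expR (a t))%:E) //.
apply: smeasM; last by apply: smeas_prod; exact: measurableT_comp.
by apply: smeasM; [exact: smeas_prod_norm|exact: mboltz].
Qed.

Variable good : set T.
Hypotheses (mgood : measurable good) (good_ae : mu (~` good) = 0).
Hypothesis ks : forall x, good x ->
  \sum_(1 <= k <oo) ((k`!%:R^-1)%:E * sint mu z k (ks_weight x)) <= (expR (a x) - 1)%:E.

Let bound xs : \bar R := (boltzr f xs * \prod_(x <- xs) expR (a x))%:E.

(** Without roots only the term [k = 0] survives, with value 1. Otherwise the bound at [xs ++ u] is
    split into the bound at [xs], which leaves the integral, and a factor that turns the integrand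
    into [ks_weight x u]. The product of the [1 + f x x'] finally completes [boltzr f xs] to
    [boltzr f (x :: xs)]. *)
Lemma psi_trunc_le K xs : (forall x, x \in xs -> good x) -> psi_trunc K xs <= bound xs.
Proof.
have [N] := ubnP (size xs + K)%N; elim: N K xs => // N IH K [|x xs].
  move=> _ _; rewrite /psi_trunc big_ord_recl big1; last first.
    move=> i _; rewrite /psi_int (@eq_sint _ _ _ mu z _ _ (fun=> 0)) ?sint0 ?mule0 //.
    by case=> // y s _; rewrite /P psir_nil normr0.
  by rewrite adde0 /psi_int /bound /P /sint /= psir_nil normr1 big_nil fact0 invr1 !mule1 mulr1.
rewrite /= addSn ltnS => sN gx.
have gxs y : y \in xs -> good y by move=> ?; apply: gx; rewrite inE orbC; apply/orP; left.
rewrite psi_trunc_cons.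
have bd0 : 0 <= bound xs.
  rewrite lee_fin mulr_ge0 ?prodr_ge0 ?boltzr_ge0 // => *; exact: expR_ge0.
have K0 k : 0 <= (k`!%:R^-1)%:E * sint mu z k (ks_weight x).
  by rewrite mule_ge0 // sint_ge0 //; exact: ks_weight_ge0.
have S_le : \sum_(i < K.+1) (i`!%:R^-1)%:E * sint mu z i (ks_weight x) <= (expR (a x))%:E.
  rewrite big_ord_recl fact0 invr1 mul1e {1}/sint /= /ks_weight !big_nil /= !mulr1.
  have -> : expR (a x) = (1 + (expR (a x) - 1))%R by ring.
  rewrite EFinD; apply: leeD => //.
  apply: le_trans (ks (gx _ (mem_head _ _))).
  rewrite -(big_mkord xpredT (fun i => (i.+1`!%:R^-1)%:E * sint mu z i.+1 (ks_weight x))).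
  rewrite -(big_add1 _ _ 0 K.+1 xpredT (fun i => (i`!%:R^-1)%:E * sint mu z i (ks_weight x))).
  by apply: nneseries_lim_ge => k _ _.
have B_le : \sum_(i < K.+1) (i`!%:R^-1)%:E *
    sint mu z i (fun u => (\prod_(y <- u) `|f x y|)%:E * psi_trunc (K - i) (xs ++ u))
    <= bound xs * (expR (a x))%:E.
  apply: le_trans (lee_wpmul2l bd0 S_le).
  rewrite ge0_sume_distrr //; apply: lee_sum => i _.
  rewrite muleCA lee_wpmul2l // -sintZ //; last 2 first.
  - exact: smeas_ks_weight.
  - exact: ks_weight_ge0.
  (* The new roots [u] have to be good points for the induction hypothesis, which holds up to a null
     set in each variable. *)
  apply: (ae_le_sint mz z_ge0 mgood good_ae).
  - apply: smeasM; first exact: smeas_prod_norm.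
    by apply: smeas_sum => k; exact: smeas_psi_int.
  - by apply: smeasM; [exact: smeas_cst|exact: smeas_ks_weight].
  - move=> s; rewrite mule_ge0 ?lee_fin ?prodr_ge0 //.
    by apply: sume_ge0 => k _; exact: psi_int_ge0.
  - by move=> s; rewrite mule_ge0 // ks_weight_ge0.
  move=> u ui gu.
  have IHu : psi_trunc (K - i) (xs ++ u) <= bound (xs ++ u).
    apply: IH; first by rewrite size_cat ui -addnA subnKC // -ltnS.
    by move=> y; rewrite mem_cat => /orP[/gxs|/gu].
  apply: le_trans (lee_wpmul2l _ IHu) _; first by rewrite lee_fin prodr_ge0.
  rewrite /bound /ks_weight -!EFinM lee_fin big_cat /=.
  set p1 := (\prod_(y <- u) `|_|)%R; set p2 := (\prod_(y <- xs) _)%R.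
  set p3 := (\prod_(y <- u) expR _)%R.
  rewrite (_ : boltzr f xs * p2 * _ = p1 * ((boltzr f xs * boltzr f u) * (p2 * p3)))%R; last by ring.
  rewrite ler_wpM2l ?prodr_ge0 // ler_wpM2r ?boltzr_cat_le //.
  by rewrite mulr_ge0 ?prodr_ge0 // => *; exact: expR_ge0.
apply: le_trans (lee_wpmul2l _ B_le) _; first by rewrite lee_fin prodr_ge0.
rewrite /bound -!EFinM lee_fin /= big_cons.
by rewrite le_eqVlt; apply/orP; left; apply/eqP; ring.
Qed.

Lemma psi_series_le xs : (forall x, x \in xs -> good x) ->
  \sum_(k <oo) psi_int k xs <= bound xs.
Proof.
move=> gxs; apply: lime_le.
  by apply: is_cvg_nneseries => k _ _; exact: psi_int_ge0.
(* [psi_trunc K] has [K + 1] terms, which leaves the empty partial sum apart. *)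
apply: nearW => -[|K]; last by rewrite /= big_mkord; exact: psi_trunc_le.
rewrite big_geq // lee_fin mulr_ge0 ?prodr_ge0 ?boltzr_ge0 // => *.
Qed.

End ConvergenceBound.

(** * Correlation functions *)

Section Series.
Context {R : realType}.
Local Open Scope ereal_scope.

Lemma nneseries_cauchy_product (a : nat -> R) (b : nat -> \bar R) :
  (forall k, 0 <= a k)%R -> (forall k, 0 <= b k) -> \sum_(j <oo) b j \is a fin_num ->
  \sum_(m <oo) \sum_(k < m.+1) (a k)%:E * b (m - k)%N =
  (\sum_(k <oo) (a k)%:E) * \sum_(j <oo) b j.
Proof.
move=> a0 b0 bfin.
(* Extension by zero off the triangle [k <= m] gives a double series of nonnegative terms whose
   order of summation can be exchanged. *)
pose t m k := if (k <= m)%N then (a k)%:E * b (m - k)%N else 0.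
have t0 m k : 0 <= t m k by rewrite /t; case: ifP => // _; rewrite mule_ge0 ?lee_fin.
transitivity (\sum_(m <oo) \sum_(k <oo) t m k).
  apply: eq_eseriesr => m _; rewrite (nneseries_split 0 m.+1) // add0n.
  rewrite eseries0 ?adde0; last first.
    by move=> k; rewrite /t => mk _; rewrite leqNgt mk.
  rewrite big_mkord; apply: eq_bigr => k _.
  by rewrite /t -ltnS ltn_ord.
rewrite nneseries_interchange //.
transitivity (\sum_(k <oo) (a k)%:E * \sum_(j <oo) b j).
  apply: eq_eseriesr => k _; rewrite (nneseries_split 0 k) // add0n.
  rewrite big1_seq ?add0e; last first.
    by move=> m; rewrite mem_index_iota /t => /and3P[_ _ mk]; rewrite leqNgt mk.
  rewrite -nneseries_addn // -nneseriesZl //; apply: eq_eseriesr => j _.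
  by rewrite /t leq_addl addnK.
rewrite -(fineK bfin) muleC -nneseriesZl //.
  by apply: eq_eseriesr => k _; rewrite muleC.
by move=> k _; rewrite lee_fin.
Qed.

(** With both sums finite, the partial sums of the differences converge to the difference. The term
    of index 0 is set apart to match the form of the expansion, whose series starts at 1. *)
Lemma eseriesB (a b : nat -> R) : (forall k, 0 <= a k)%R -> (forall k, 0 <= b k)%R ->
  \sum_(k <oo) (a k)%:E < +oo -> \sum_(k <oo) (b k)%:E < +oo ->
  (a 0%N - b 0%N)%:E + \sum_(1 <= k <oo) (a k - b k)%:E =
  \sum_(k <oo) (a k)%:E - \sum_(k <oo) (b k)%:E.
Proof.
move=> a0 b0 aoo boo.
have sfin (c : nat -> R) : (forall k, 0 <= c k)%R -> \sum_(k <oo) (c k)%:E < +oo ->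
    \sum_(k <oo) (c k)%:E \is a fin_num.
  by move=> c0 coo; rewrite ge0_fin_numE // nneseries_ge0 // => k _ _; rewrite lee_fin.
have scvg (c : nat -> R) : (forall k, 0 <= c k)%R ->
    (fun n => \sum_(0 <= k < n) (c k)%:E) @ \oo --> \sum_(k <oo) (c k)%:E.
  by move=> c0; apply: is_cvg_nneseries => k _ _; rewrite lee_fin.
set S := RHS.
have Sfin : S \is a fin_num by rewrite fin_numB !sfin.
have cS : (fun n => \sum_(0 <= k < n) (a k - b k)%:E) @ \oo --> S.
  rewrite (_ : (fun _ => _) = fun n =>
      \sum_(0 <= k < n) (a k)%:E - \sum_(0 <= k < n) (b k)%:E).
    by apply: cvgeB; rewrite ?fin_num_adde_defl ?fin_numN ?sfin //; exact: scvg.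
  by apply/funext => n; rewrite !sumEFin -EFinB; congr EFin; rewrite sumrB.
have c1 : (fun n => \sum_(1 <= k < n) (a k - b k)%:E) @ \oo --> S - (a 0%N - b 0%N)%:E.
  have : (fun n => \sum_(0 <= k < n) (a k - b k)%:E - (a 0%N - b 0%N)%:E) @ \oo -->
      S - (a 0%N - b 0%N)%:E.
    by apply: cvgeB => //; [exact: fin_num_adde_defr|exact: cvg_cst].
  apply: cvg_trans; apply: near_eq_cvg; near=> n.
  have n0 : (0 < n)%N by near: n; exists 1%N.
  by rewrite (big_ltn n0) addeAC subee // add0e.
rewrite (cvg_lim _ c1) //.
by rewrite addeC subeK.
Unshelve. all: by end_near.
Qed.

Lemma nneseries_exp (c : R) : \sum_(m <oo) (m`!%:R^-1 * c ^+ m)%:E = (expR c)%:E.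
Proof.
rewrite /expR -EFin_lim; last exact: is_cvg_series_exp_coeff.
congr (lim (_ @ \oo)); apply/funext => n; rewrite sumEFin /series /=; congr EFin.
by apply: eq_bigr => k _; rewrite /exp_coeff /= mulrC.
Qed.

End Series.

Section Correlations.
Context {d : measure_display} {T : measurableType d} {R : realType}.
Variables (mu : {sigma_finite_measure set T -> \bar R}) (f : T -> T -> R) (w : T -> R).
Hypothesis fC : forall x y, f x y = f y x.
Hypotheses (f_le0 : forall x y, f x y <= 0) (f_geN1 : forall x y, 0 <= 1 + f x y).
Hypothesis mpsi : smeas2 (fun xs ys => (psir f xs ys)%:E).
Hypothesis mboltz : smeas (fun s => (boltzr f s)%:E).
Hypotheses (mw : measurable_fun setT w) (w_ge0 : forall x, 0 <= w x).
Variable c : R.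
Hypothesis wc : (\int[mu]_x (w x)%:E)%E = c%:E.
Local Open Scope ereal_scope.

Let E s : \bar R := (boltzr f s)%:E.
Let P xs ys : \bar R := `|psir f xs ys|%:E.

Let E0 s : 0 <= E s. Proof. by rewrite lee_fin boltzr_ge0. Qed.
Let P0 xs ys : 0 <= P xs ys. Proof. by rewrite lee_fin. Qed.
Let mP : smeas2 P. Proof. exact: smeas2_norm_psir. Qed.

Let mE2 : smeas2 (fun xs ys => E (xs ++ ys)).
Proof.
by move=> m n; apply: (smeas_comp mboltz); apply: mseq_cat; exact: mseq_tval.
Qed.

Let mEl xs : smeas (fun ys => E (xs ++ ys)).
Proof. exact: smeas2r mE2. Qed.

Definition boltz_int m xs : \bar R := (m`!%:R^-1)%:E * sint mu w m (fun ys => E (xs ++ ys)).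

Lemma boltz_int_ge0 m xs : 0 <= boltz_int m xs.
Proof. by rewrite mule_ge0 // sint_ge0. Qed.

Lemma smeas_boltz_int m : smeas (boltz_int m).
Proof.
apply: smeasM; first exact: smeas_cst.
exact: (smeas_sint mu mw w_ge0 m mE2).
Qed.

Lemma c_ge0 : (0 <= c)%R.
Proof. by rewrite -lee_fin -wc; apply: integral_ge0 => x _; rewrite lee_fin. Qed.

Lemma sint1E m : sint mu w m (fun=> 1) = (c ^+ m)%:E.
Proof.
elim: m => [//|m IH]; rewrite sintS; under eq_integral do rewrite IH.
under eq_integral do rewrite muleC.
rewrite ge0_integralZl //.
- by rewrite wc -EFinM exprSr.
- exact/measurable_EFinP.
- by move=> x _; rewrite lee_fin.
- by rewrite lee_fin exprn_ge0 // c_ge0.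
Qed.

Lemma boltz_int_le m xs : boltz_int m xs <= boltz_int m [::].
Proof.
rewrite lee_wpmul2l //; apply: le_sint => // s _; rewrite lee_fin.
apply: le_trans (boltzr_cat_le f f_le0 f_geN1 xs s) _.
by rewrite ler_piMl ?boltzr_ge0 // boltzr_le1.
Qed.

Definition grand_partition := \sum_(m <oo) boltz_int m [::].

Lemma grand_partition_le : grand_partition <= (expR c)%:E.
Proof.
rewrite -nneseries_exp; apply: lee_nneseries => [m _ _|m _]; first exact: boltz_int_ge0.
rewrite EFinM lee_wpmul2l // -sint1E; apply: le_sint => //.
by move=> s _; rewrite lee_fin boltzr_le1.
Qed.

(** The term [m = 0] is already 1. Together with the upper bound [expR c], this makes the
    normalisation a positive real by which one can divide. *)
Lemma grand_partition_ge1 : 1 <= grand_partition.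
Proof.
have {1}-> : 1 = \sum_(0 <= m < 1) boltz_int m [::].
  by rewrite big_nat1 /boltz_int fact0 invr1 mul1e.
by apply: nneseries_lim_ge => m _ _; exact: boltz_int_ge0.
Qed.

Lemma grand_partition_fin : grand_partition \is a fin_num.
Proof.
rewrite ge0_fin_numE; first exact: le_lt_trans grand_partition_le (ltry _).
by apply: le_trans grand_partition_ge1; rewrite lee_fin.
Qed.

(* [psir] has the sign of [(-1)^k], so the convolution identity is integrated with
   its odd part moved to the left, where every term is nonnegative. *)
Lemma boltz_int_split xs m :
  boltz_int m xs +
  \sum_(k < m.+1) (odd k)%:R%:E * psi_int mu f w k xs * boltz_int (m - k) [::] =
  \sum_(k < m.+1) (~~ odd k)%:R%:E * psi_int mu f w k xs * boltz_int (m - k) [::].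
Proof.
(* The factor [b (size u)] keeps the splittings with [|u|] of one parity, so that one computation
   serves both sides. *)
pose G (b : nat -> bool) u r := (b (size u))%:R%:E * P xs u * E r.
have mG b : smeas2 (G b).
  move=> i j; apply: emeasurable_funM.
    under eq_fun do rewrite size_tuple.
    apply: emeasurable_funM => //.
    apply: (smeas_comp (smeas2r xs mP)); exact: mseq_tval.
  by apply: (smeas_comp mboltz); exact: mseq_tval.
have G0 b u r : 0 <= G b u r.
  by apply: mule_ge0 => //; apply: mule_ge0 => //; rewrite lee_fin ler0n.
have intG b : (m`!%:R^-1)%:E * sint mu w m (split_sum (G b)) =
    \sum_(k < m.+1) (b k)%:R%:E * psi_int mu f w k xs * boltz_int (m - k) [::].
  rewrite sint_split_sum_fact //; apply: eq_bigr => k _.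
  rewrite [RHS]muleAC [RHS]muleCA; congr (_ * _).
  have mPx : smeas (P xs) by exact: (smeas2r xs mP).
  have b0 : 0 <= (b k)%:R%:E :> \bar R by rewrite lee_fin ler0n.
  rewrite -sintZ //; last by rewrite mule_ge0 // boltz_int_ge0.
  apply: eq_sint => u uk; rewrite /G uk sintZ //; last by rewrite mule_ge0.
  by rewrite muleCA /boltz_int [RHS]muleAC.
have S0 b : 0 <= sint mu w m (split_sum (G b)).
  by apply: sint_ge0 => // s; exact: split_sum_ge0e.
rewrite -(intG odd) -(intG (fun k => ~~ odd k)) /boltz_int -ge0_muleDr ?S0 //;
  last exact: sint_ge0.
congr (_ * _); rewrite -sintD //; last 2 first.
- exact: smeas_split_sum.
- by move=> s; exact: split_sum_ge0e.
apply: eq_sint => ys _; rewrite /E boltzr_split // EFin_split_sum -split_sumD.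
apply: eq_split_sum => u r _; rewrite /G /P /E -!EFinM -EFinD; congr EFin.
have := psir_sign f f_le0 f_geN1 xs u; set q := `|_|%R => ->.
by rewrite -signr_odd; case: odd => /=; rewrite ?expr1 ?expr0; ring.
Qed.

Section Expansion.
Variable xs : seq T.
Hypothesis psi_summable : \sum_(k <oo) psi_int mu f w k xs < +oo.

Let p k : R := fine (psi_int mu f w k xs).
Let pE k : (p k)%:E = psi_int mu f w k xs.
Proof.
rewrite fineK // ge0_fin_numE ?psi_int_ge0 //; apply: le_lt_trans psi_summable.
apply: le_trans (nneseries_lim_ge k.+1 _); last by move=> n _ _; exact: psi_int_ge0.
by rewrite big_nat_recr //= leeDr // sume_ge0 // => n _; exact: psi_int_ge0.
Qed.
Let p0 k : (0 <= p k)%R. Proof. by rewrite fine_ge0 // psi_int_ge0. Qed.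

Let part (b : nat -> bool) k : R := (b k)%:R * p k.
Let part0 b k : (0 <= part b k)%R. Proof. by rewrite mulr_ge0. Qed.
Let part_lt b : \sum_(k <oo) (part b k)%:E < +oo.
Proof.
apply: le_lt_trans psi_summable; apply: lee_nneseries => [k _ _|k _]; first by rewrite lee_fin.
by rewrite -pE lee_fin /part; case: (b k); rewrite ?mul1r ?mul0r.
Qed.

(** Summing [boltz_int_split] over [m] gives [S + O * Xi = V * Xi], where [S] is the Boltzmann
    series and [O], [V] are the odd and even parts of the [psi] series. Summability makes [O * Xi]
    finite, so it may be subtracted, and [V - O] is the alternating series. *)
Lemma boltz_series_expansion :
  (fine grand_partition)^-1%:E * \sum_(m <oo) boltz_int m xs =
  (p 0%N)%:E + \sum_(1 <= k <oo) ((-1) ^+ k * p k)%:E.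
Proof.
have Xfin := grand_partition_fin.
have sfin b : \sum_(k <oo) (part b k)%:E \is a fin_num.
  by rewrite ge0_fin_numE // nneseries_ge0 // => k _ _; rewrite lee_fin.
have cauchy (b : nat -> bool) : \sum_(m <oo) \sum_(k < m.+1) (b k)%:R%:E * psi_int mu f w k xs * boltz_int (m - k) [::] =
    (\sum_(k <oo) (part b k)%:E) * grand_partition.
  rewrite -nneseries_cauchy_product //; last by move=> k; exact: boltz_int_ge0.
  apply: eq_eseriesr => m _; apply: eq_bigr => k _.
  by rewrite /part EFinM pE.
have B0 (b : nat -> bool) m :
    0 <= \sum_(k < m.+1) (b k)%:R%:E * psi_int mu f w k xs * boltz_int (m - k) [::].
  apply: sume_ge0 => k _; rewrite mule_ge0 ?boltz_int_ge0 // mule_ge0 ?psi_int_ge0 //.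
have sum_eq : \sum_(m <oo) boltz_int m xs + (\sum_(k <oo) (part odd k)%:E) * grand_partition =
    (\sum_(k <oo) (part (fun k => ~~ odd k) k)%:E) * grand_partition.
  rewrite -!cauchy -nneseriesD; last 2 first.
  - by move=> m _ _; exact: boltz_int_ge0.
  - by move=> m _ _; exact: B0.
  by apply: eq_eseriesr => m _; exact: boltz_int_split.
have -> : \sum_(m <oo) boltz_int m xs =
    (\sum_(k <oo) (part (fun k => ~~ odd k) k)%:E - \sum_(k <oo) (part odd k)%:E) * grand_partition.
  rewrite muleBl ?fin_num_adde_defr ?sfin // -sum_eq addeK //.
  by rewrite fin_numM ?sfin.
rewrite muleC -muleA -{1}(fineK Xfin) -EFinM mulfV ?mule1; last first.
  rewrite gt_eqF // -lte_fin fineK //.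
  by apply: lt_le_trans grand_partition_ge1; rewrite lte_fin.
rewrite -eseriesB //; congr (_ + _).
  by rewrite /part /= mul1r mul0r subr0.
apply: eq_eseriesr => k _; rewrite /part -mulrBl -signr_odd; congr (_ * _)%:E.
by case: odd; rewrite /= ?expr1 ?expr0; ring.
Qed.

End Expansion.

Section FactorialMoments.
Variables (x0 : T) (n : nat) (g : seq T -> R).
Hypotheses (mg : smeas (fun u => (g u)%:E)) (g0 : forall u, (0 <= g u)%R).

Definition positions m (s : {ffun 'I_n -> 'I_m}) : seq nat :=
  [seq val (s i) | i <- enum 'I_n].

(** A version of [fact_sum] on sequences; the default [x0] is never read when [y] has length [m]. *)
Definition fact_sum_seq m (y : seq T) : \bar R :=
  \sum_(s : {ffun 'I_n -> 'I_m} | injectiveb s) (g (map (nth x0 y) (positions s)))%:E.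

(** By [sint_select] each of the [m ^_ n] injections contributes the same integral. *)
Lemma sint_fact_sum m :
  sint mu w m (fun y => fact_sum_seq m y * E y) =
  (m ^_ n)%:R%:E *
  sint mu w n (fun u => (g u)%:E * sint mu w (m - n) (fun s => E (u ++ s))).
Proof.
set S := sint mu w n _.
have g0e u : 0 <= (g u)%:E by rewrite lee_fin.
have S0 : 0 <= S by apply: sint_ge0 => // u; rewrite mule_ge0 // sint_ge0.
pose F (s : {ffun 'I_n -> 'I_m}) y := (g (map (nth x0 y) (positions s)))%:E * E y.
have mF s : smeas (F s).
  move=> k; apply: emeasurable_funM; last exact: mboltz.
  by apply: (smeas_comp mg); apply: mseq_nth; exact: mseq_tval.
have F0 s y : 0 <= F s y by rewrite mule_ge0.
transitivity (\sum_(s : {ffun 'I_n -> 'I_m} | injectiveb s) sint mu w m (F s)).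
  rewrite -big_filter -sint_sum //; apply: eq_sint => y _.
  by rewrite big_filter /fact_sum_seq ge0_sume_distrl.
transitivity (\sum_(s : {ffun 'I_n -> 'I_m} | injectiveb s) 1%:E * S).
  apply: eq_bigr => s /injectiveP inj_s; rewrite mul1e.
  have sz : size (positions s) = n by rewrite size_map size_enum_ord.
  rewrite /S -sz; apply: (@sint_select _ _ _ mu w mw w_ge0 x0 (positions s) m
    (fun u => (g u)%:E) E) => //.
  - by rewrite map_inj_uniq ?enum_uniq // => i j /val_inj /inj_s.
  - by apply/allP => _ /mapP[i _ ->] /=.
  - by move=> r t rt; rewrite /E (boltzr_perm f fC _ _ rt).
rewrite -ge0_sume_distrl // sumEFin sumr_const; congr (_%:R%:E * _).
by rewrite -cardsE card_inj_ffuns !card_ord.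
Qed.

(** Since [m ^_ n / m! = 1 / (m - n)!], the shift [m = n + j] turns the terms with [m >= n] into
    those of the Boltzmann series; the terms with [m < n] admit no injection and vanish. *)
Lemma factorial_moment :
  \sum_(m <oo) (m`!%:R^-1)%:E * sint mu w m (fun y => fact_sum_seq m y * E y) =
  sint mu w n (fun u => (g u)%:E * \sum_(j <oo) boltz_int j u).
Proof.
have g0e u : 0 <= (g u)%:E by rewrite lee_fin.
pose I j := sint mu w n (fun u => (g u)%:E * boltz_int j u).
have I0 j : 0 <= I j by apply: sint_ge0 => // u; rewrite mule_ge0 // boltz_int_ge0.
transitivity (\sum_(m <oo) if (n <= m)%N then I (m - n)%N else 0).
  apply: eq_eseriesr => m _; rewrite sint_fact_sum; case: leqP => nm; last first.
    by rewrite ffact_small // mul0e mule0.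
  have -> : I (m - n)%N = ((m - n)`!%:R^-1)%:E *
      sint mu w n (fun u => (g u)%:E * sint mu w (m - n) (fun s => E (u ++ s))).
    rewrite -sintZ //.
    - by apply: eq_sint => u _; rewrite /boltz_int muleCA.
    - apply: smeasM => //; exact: (smeas_sint mu mw w_ge0 (m - n)%N mE2).
    - by move=> u; rewrite mule_ge0 // sint_ge0.
  rewrite muleA -EFinM; congr (_%:E * _).
  have fnz k : (k`!%:R : R) != 0%R by rewrite pnatr_eq0 -lt0n fact_gt0.
  by rewrite -(ffact_fact nm) natrM; field; rewrite !fnz pnatr_eq0 -lt0n ffact_gt0 nm.
rewrite (nneseries_split 0 n); last by move=> k _; case: ifP.
rewrite add0n big1_seq ?add0e; last first.
  by move=> m; rewrite mem_index_iota => /and3P[_ _ mn]; rewrite leqNgt mn.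
rewrite -nneseries_addn; last by move=> k; case: ifP.
under eq_eseriesr do rewrite leq_addl addnK.
rewrite -sint_nneseries //.
- apply: eq_sint => u _; rewrite nneseriesZl // => j _; exact: boltz_int_ge0.
- by move=> j; apply: smeasM => //; exact: smeas_boltz_int.
- by move=> j s; rewrite mule_ge0 // boltz_int_ge0.
Qed.

End FactorialMoments.

End Correlations.

(** * Product null sets and uniqueness of densities *)

Section ProductNullSets.
Context {d : measure_display} {T : measurableType d} {R : realType}.
Variable mu : {sigma_finite_measure set T -> \bar R}.
Local Open Scope ereal_scope.
Implicit Types n : nat.

Let m1 : measurable_fun setT (fun _ : T => 1%R : R). Proof. exact: measurable_cst. Qed.
Let one_ge0 (x : T) : (0 <= (1 : R))%R. Proof. by []. Qed.

Lemma wint1D n (F G : n.-tuple T -> \bar R) : measurable_fun setT F -> measurable_fun setT G ->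
  (forall t, 0 <= F t) -> (forall t, 0 <= G t) ->
  wint mu setT (fun=> 1%R) (fun t => F t + G t) =
  wint mu setT (fun=> 1%R) F + wint mu setT (fun=> 1%R) G.
Proof.
move=> mF mG F0 G0; rewrite -!sint_seqext -sintD //; try exact: smeas_seqext.
- apply: eq_sint => s sn; rewrite -[s]/(tval (Tuple (introT eqP sn))).
  by rewrite !seqextE.
- by move=> s; exact: seqext_ge0.
- by move=> s; exact: seqext_ge0.
Qed.

Lemma wint1_eq0 n (F G : n.-tuple T -> \bar R) : measurable_fun setT F -> measurable_fun setT G ->
  (forall t, 0 <= F t) -> (forall t, 0 <= G t) -> (forall t, F t = 0 -> G t = 0) ->
  wint mu setT (fun=> 1%R) F = 0 -> wint mu setT (fun=> 1%R) G = 0.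
Proof.
move=> mF mG F0 G0 FG; rewrite -!sint_seqext; apply: sint_eq0 => //; try exact: smeas_seqext.
- by move=> s; exact: seqext_ge0.
- by move=> s; exact: seqext_ge0.
- move=> s sn; rewrite -[s]/(tval (Tuple (introT eqP sn))) !seqextE; exact: FG.
Qed.

Lemma wint1_ae_le n (good : set T) (F G : n.-tuple T -> \bar R) :
  measurable good -> mu (~` good) = 0 ->
  measurable_fun setT F -> measurable_fun setT G ->
  (forall t, 0 <= F t) -> (forall t, 0 <= G t) ->
  (forall t, (forall i, good (tnth t i)) -> F t <= G t) ->
  wint mu setT (fun=> 1%R) F <= wint mu setT (fun=> 1%R) G.
Proof.
move=> mg g0 mF mG F0 G0 FG; rewrite -!sint_seqext.
apply: (ae_le_sint m1 one_ge0 mg g0); try exact: smeas_seqext.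
- by move=> s; exact: seqext_ge0.
- by move=> s; exact: seqext_ge0.
move=> s sn gs; rewrite -[s]/(tval (Tuple (introT eqP sn))) !seqextE; apply: FG => i.
by apply: gs; rewrite -[X in _ \in X]/(tval (Tuple (introT eqP sn))) mem_tnth.
Qed.

(** The tuples with some coordinate outside [good] form a finite union of cylinders, which the
    iterated integral does not see; adding them to [B] keeps it null. *)
Lemma ae_prod_good n (good : set T) (B : set (n.-tuple T)) (Q : n.-tuple T -> Prop) :
  measurable good -> mu (~` good) = 0 -> measurable B -> prodm mu B = 0 ->
  (forall t, ~ B t -> (forall i, good (tnth t i)) -> Q t) -> ae_prod mu Q.
Proof.
move=> mg g0 mB B0 BQ.
pose N := B `|` \bigcup_(i in [set: 'I_n]) (fun t => tnth t i) @^-1` (~` good).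
have mN : measurable N.
  apply: measurableU => //; apply: fin_bigcup_measurable => // i _.
  by rewrite -[X in measurable X]setTI; apply: measurable_tnth => //; exact: measurableC.
exists N; split => //.
- apply/eqP; rewrite eq_le; apply/andP; split; last first.
    by rewrite /prodm -sint_seqext; apply: sint_ge0 => // s; apply: seqext_ge0 => t; rewrite lee_fin.
  rewrite -B0; apply: (wint1_ae_le mg g0).
  + by apply/measurable_EFinP; exact: measurable_indic.
  + by apply/measurable_EFinP; exact: measurable_indic.
  + by move=> t; rewrite lee_fin.
  + by move=> t; rewrite lee_fin.
  + move=> t gt; rewrite lee_fin !indicE ler_nat.
    case: (boolP (t \in N)) => //; rewrite inE => -[|[i _ /= ngi]]; first by move=> /mem_set ->.
    by have := ngi (gt i).
- move=> t Nt; apply: BQ; first by move=> Bt; apply: Nt; left.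
  by move=> i; apply: contrapT => ngi; apply: Nt; right; exists i.
Qed.

(** On [A] the inequality [F < G] makes [F] finite, so [G - F] is well defined and positive there.
    As the common integral is finite it cancels, [G - F] integrates to 0 over [A], and [A] must be
    null. *)
Lemma null_of_density_gap n (A : set (n.-tuple T)) (F G : n.-tuple T -> \bar R) :
  measurable A -> measurable_fun setT F -> measurable_fun setT G ->
  (forall t, 0 <= F t) -> (forall t, 0 <= G t) -> (forall t, A t -> F t < G t) ->
  wint mu setT (fun=> 1%R) (fun t => (\1_A t)%:E * F t) < +oo ->
  wint mu setT (fun=> 1%R) (fun t => (\1_A t)%:E * F t) =
  wint mu setT (fun=> 1%R) (fun t => (\1_A t)%:E * G t) ->
  prodm mu A = 0.
Proof.
move=> mA mF mG F0 G0 FG Ifin IFG.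
have m1A : measurable_fun setT (fun t => (\1_A t)%:E : \bar R).
  by apply/measurable_EFinP; exact: measurable_indic.
pose h t := (\1_A t)%:E * (G t - F t).
have mh : measurable_fun setT h.
  by apply: emeasurable_funM => //; exact: emeasurable_funB.
have h0 t : 0 <= h t.
  rewrite /h indicE; case: (boolP (t \in A)) => [|_]; last by rewrite mul0e.
  by rewrite inE => /FG FGt; rewrite mul1e sube_ge0 ?ltW // (ge0_fin_numE (F0 t)) (lt_le_trans FGt) ?leey.
have IE : wint mu setT (fun=> 1%R) (fun t => (\1_A t)%:E * G t) =
    wint mu setT (fun=> 1%R) h + wint mu setT (fun=> 1%R) (fun t => (\1_A t)%:E * F t).
  rewrite -wint1D //.
  - congr wint; apply/funext => t; rewrite /h indicE.
    case: (boolP (t \in A)) => [|_]; last by rewrite !mul0e adde0.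
    rewrite inE => /FG FGt; rewrite !mul1e subeK //.
    by rewrite (ge0_fin_numE (F0 t)) (lt_le_trans FGt) ?leey.
  - exact: emeasurable_funM.
  - by move=> t; rewrite mule_ge0 ?lee_fin.
have h_eq0 : wint mu setT (fun=> 1%R) h = 0.
  have Ige0 : 0 <= wint mu setT (fun=> 1%R) (fun t => (\1_A t)%:E * F t).
    rewrite -sint_seqext; apply: sint_ge0 => // s.
    by apply: seqext_ge0 => t; rewrite mule_ge0 ?lee_fin.
  move: Ifin Ige0 IE; rewrite -IFG; set X := wint _ _ _ (fun t => _ * F t) => Xoo X0 XE.
  have Xfin : X \is a fin_num by rewrite ge0_fin_numE.
  by rewrite -[LHS](addeK _ Xfin) -XE subee.
apply: (wint1_eq0 _ _ _ _ _ h_eq0) => //.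
move=> t /eqP; rewrite mule_eq0 => /orP[/eqP //|/eqP GF].
rewrite indicE; case: (boolP (t \in A)) => // /[!inE] /FG FGt.
by move: FGt; rewrite -sube_gt0 GF ltxx.
Qed.

(** The gap lemma is applied to the sets where [F - G] is positive and where it is negative, with
    the roles of [F] and [G] exchanged. Finiteness is asked of [G] only; the equality of integrals
    passes it on to [F]. *)
Lemma density_unique n (F G : n.-tuple T -> \bar R) :
  measurable_fun setT F -> measurable_fun setT G ->
  (forall t, 0 <= F t) -> (forall t, 0 <= G t) -> (forall t, G t \is a fin_num) ->
  wint mu setT (fun=> 1%R) G < +oo ->
  (forall A, measurable A ->
     wint mu setT (fun=> 1%R) (fun t => (\1_A t)%:E * F t) =
     wint mu setT (fun=> 1%R) (fun t => (\1_A t)%:E * G t)) ->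
  exists B, [/\ measurable B, prodm mu B = 0 & forall t, ~ B t -> F t = G t].
Proof.
move=> mF mG F0 G0 Gfin IG FG.
have mD : measurable_fun setT (fun t => F t - G t) by exact: emeasurable_funB.
have mE := @emeasurable_fun_o_infty _ _ _ _ _ measurableT mD 0.
have mE' := @emeasurable_fun_infty_o _ _ _ _ _ measurableT mD 0.
move: mE mE'; rewrite !setTI.
set P := [set t | 0 < F t - G t]; set N := [set t | F t - G t < 0] => mP mN.
have IAG A : measurable A -> wint mu setT (fun=> 1%R) (fun t => (\1_A t)%:E * G t) < +oo.
  move=> mA; apply: le_lt_trans IG; apply: (wint1_ae_le measurableT).
  - by rewrite setCT measure0.
  - by apply: emeasurable_funM => //; apply/measurable_EFinP; exact: measurable_indic.
  - by [].
  - by move=> t; rewrite mule_ge0 ?lee_fin.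
  - by [].
  - move=> t _; rewrite indicE; case: (t \in A); rewrite ?mul1e ?mul0e //.
have P0 : prodm mu P = 0.
  apply: (null_of_density_gap mP mG mF) => //; last by rewrite FG.
  - by move=> t; rewrite /P /= sube_gt0.
  - exact: IAG.
have N0 : prodm mu N = 0.
  apply: (null_of_density_gap mN mF mG) => //.
  - by move=> t; rewrite /N /= suber_lt0.
  - by rewrite FG //; exact: IAG.
  - by rewrite FG.
have mi (A : set (n.-tuple T)) : measurable A -> measurable_fun setT (fun t => (\1_A t)%:E : \bar R).
  by move=> mA; apply/measurable_EFinP; exact: measurable_indic.
exists (P `|` N); split; first exact: measurableU.
- apply/eqP; rewrite eq_le; apply/andP; split; last first.
    by rewrite /prodm -sint_seqext; apply: sint_ge0 => // s; apply: seqext_ge0 => t; rewrite lee_fin.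
  rewrite -[0]adde0 -{1}P0 -N0 /prodm -wint1D; try exact: mi; try by move=> t; rewrite lee_fin.
  apply: (wint1_ae_le measurableT).
  + by rewrite setCT measure0.
  + by apply: mi; exact: measurableU.
  + by apply: emeasurable_funD; exact: mi.
  + by move=> t; rewrite lee_fin.
  + by move=> t; rewrite adde_ge0 ?lee_fin.
  move=> t _; rewrite !indicE in_setU -EFinD lee_fin.
  by case: (t \in P); case: (t \in N); rewrite /= ?addr0 ?add0r // lerDl.
- move=> t /not_orP[]; rewrite /P /N /= => /negP; rewrite -leNgt => le1 /negP; rewrite -leNgt => ge1.
  have FGt : F t - G t = 0 by apply/eqP; rewrite eq_le le1.
  by rewrite -[LHS](subeK _ (Gfin t)) FGt add0e.
Qed.

End ProductNullSets.

Lemma expeRN_sum {R : realType} {I : Type} (r : seq I) (Q : pred I) (b : I -> \bar R) :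
  (forall i, 0 <= b i)%E ->
  expeR (- \sum_(i <- r | Q i) b i)%E = (\prod_(i <- r | Q i) expeR (- b i))%E.
Proof.
move=> b0; elim: r => [|i r IH]; first by rewrite !big_nil oppe0 expeR0.
rewrite !big_cons; case: ifP => // _.
by rewrite oppeD ?expeRD ?IH // ge0_adde_def ?inE ?sume_ge0.
Qed.

(** Balls of integer radius around a fixed point are open, hence measurable, have finite measure and
    cover the space. Sigma-finiteness is what Tonelli requires. *)
Lemma sigma_finite_bounded {d : measure_display} {T : measurableType d} {R : realType}
  (dist : T -> T -> R) (lam : {measure set T -> \bar R}) :
  is_metric dist -> borel_of dist ->
  (forall B : set T, measurable B -> mbounded dist B -> (lam B < +oo)%E) ->
  sigma_finite setT lam.
Proof.
move=> [dge0 d0 dC dD] bor bfin.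
have [[x0 _]|noT] := pselect (exists x : T, True); last first.
  exists (fun=> set0); last by move=> _; rewrite measure0.
  by apply/seteqP; split => // x _; exfalso; apply: noT; exists x.
exists (fun n => mball dist x0 n%:R).
  apply/seteqP; split => // x _; exists (Num.bound (dist x0 x)) => //=.
  exact: archi_boundP.
move=> n; have mB : measurable (mball dist x0 n%:R).
  rewrite bor; apply: sub_sigma_algebra => x xB; exists (n%:R - dist x0 x).
    by rewrite subr_gt0.
  by move=> y; rewrite /mball /= ltrBrDl; apply: le_lt_trans.
by split => //; apply: bfin => //; exists x0, n%:R.
Qed.

(** * The Mayer function: bounds, measurability, link with [psi] and [boltz] *)

Section Mayer.
Context {d : measure_display} {T : measurableType d} {R : realType} (v : T -> T -> \bar R).
Hypotheses (v_ge0 : forall x y, (0 <= v x y)%E) (vC : forall x y, v x y = v y x).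
Hypothesis mv : measurable_fun setT (fun p : T * T => v p.1 p.2).

Lemma mayerC x y : mayer v x y = mayer v y x.
Proof. by rewrite /mayer vC. Qed.

Lemma expeRN_fin x y : expeR (- v x y)%E \is a fin_num.
Proof.
rewrite ge0_fin_numE ?expeR_ge0 // ltey expeR_eqy.
by case: (v x y) (v_ge0 x y).
Qed.

Lemma mayer1E x y : (1 + mayer v x y)%:E = expeR (- v x y)%E.
Proof. by rewrite /mayer addrC subrK fineK // expeRN_fin. Qed.

Lemma mayer_geN1 x y : 0 <= 1 + mayer v x y.
Proof. by rewrite -lee_fin mayer1E expeR_ge0. Qed.

Lemma mayer_le0 x y : mayer v x y <= 0.
Proof.
have : (1 + mayer v x y <= 1)%R.
  by rewrite -lee_fin mayer1E -expeR0 lee_expeR oppe_le0.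
by rewrite gerDl.
Qed.

Lemma measurable_mayer : measurable_fun setT (fun p : T * T => mayer v p.1 p.2).
Proof.
(* Where [v] is infinite, [fine v] is a meaningless default; the indicator removes it and leaves the
   value -1. *)
rewrite (_ : (fun _ => _) = fun p : T * T =>
    \1_[set q | v q.1 q.2 \is a fin_num] p * expR (- fine (v p.1 p.2)) - 1).
  apply: measurable_funB => //; apply: measurable_funM.
    apply: measurable_indic; rewrite -[X in measurable X]setTI.
    exact: emeasurable_fin_num.
  apply: measurableT_comp => //; apply: measurableT_comp => //.
  exact: measurableT_comp.
apply/funext => p; rewrite /mayer indicE; congr (_ - _).
case: (boolP (p \in _)); rewrite ?inE ?notin_setE /= => h.
  by rewrite mul1r -{1}(fineK h).
rewrite mul0r; case: (v p.1 p.2) (v_ge0 p.1 p.2) h => //=.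
Qed.

Lemma measurable_mayer_tnth n (i j : 'I_n) :
  measurable_fun setT (fun t : n.-tuple T => mayer v (tnth t i) (tnth t j)).
Proof.
exact: (measurableT_comp measurable_mayer
  (measurable_fun_pair (measurable_tnth i) (measurable_tnth j))).
Qed.

Lemma measurable_psi n k : measurable_fun setT (fun t : n.-tuple T => psi v k t).
Proof.
rewrite (_ : (fun _ => _) = fun t : n.-tuple T => \sum_(G <- enum (Dkn k n))
    \prod_(e <- enum G) mayer v (tnth t e.1) (tnth t e.2)).
  apply: measurable_sum => G; apply: measurable_prod => e _.
  exact: measurable_mayer_tnth.
by apply/funext => t; rewrite big_enum; apply: eq_bigr => G _; rewrite big_enum.
Qed.

Lemma psi_tuple_eq k m n (t : m.-tuple T) (u : n.-tuple T) :
  tval t = tval u -> psi v k t = psi v k u.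
Proof.
move=> tu; have mn : m = n by rewrite -(size_tuple t) tu size_tuple.
by subst m; congr psi; apply: val_inj.
Qed.

Lemma psi_tuple_psir n (x : n.-tuple T) : psi v n x = psir (mayer v) x [::].
Proof.
rewrite -(psi_cat_psir v n 0 x [tuple]) //.
by apply: psi_tuple_eq; rewrite /= cats0.
Qed.

(** Measurability is read off the graph sum, a finite sum of finite products. *)
Lemma smeas2_psir : smeas2 (fun xs ys => (psir (mayer v) xs ys)%:E).
Proof.
move=> m n; pose F s := (psi v m (in_tuple s))%:E.
have mF : smeas F.
  move=> k; apply/measurable_EFinP.
  rewrite (_ : (fun _ => _) = fun t : k.-tuple T => psi v m t).
    exact: measurable_psi.
  by apply/funext => t; exact: psi_tuple_eq.
rewrite (_ : (fun _ => _) = fun p : m.-tuple T * n.-tuple T => F (p.1 ++ p.2)).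
  by apply: (smeas_comp mF); apply: mseq_cat; exact: mseq_tval.
apply/funext => p; rewrite /F -psi_cat_psir //; congr EFin; exact: psi_tuple_eq.
Qed.

Lemma smeas_boltzr : smeas (fun s => (boltzr (mayer v) s)%:E).
Proof.
move=> n; apply/measurable_EFinP.
rewrite (_ : (fun _ => _) = fun t : n.-tuple T => \prod_(i <- enum 'I_n)
    \prod_(j <- enum 'I_n) if (i < j)%N then 1 + mayer v (tnth t i) (tnth t j) else 1).
  apply: measurable_prod => i _; apply: measurable_prod => j _.
  case: (i < j)%N; last exact: measurable_cst.
  by apply: measurable_funD => //; exact: measurable_mayer_tnth.
apply/funext => t; rewrite boltzr_tuple big_enum; apply: eq_bigr => i _.
by rewrite big_enum big_mkcond.
Qed.

Lemma boltz_boltzr n (t : n.-tuple T) : boltz v t = (boltzr (mayer v) t)%:E.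
Proof.
rewrite boltzr_tuple /boltz expeRN_sum; last by move=> i; exact: sume_ge0.
rewrite -prodEFin; apply: eq_bigr => i _; rewrite expeRN_sum //.
by rewrite -prodEFin; apply: eq_bigr => j _; rewrite mayer1E.
Qed.

End Mayer.

(** * The finite-volume Gibbs measure and its correlation functions *)

Section GibbsMeasure.
Context {d : measure_display} {T : measurableType d} {R : realType}.
Variables (mu : {sigma_finite_measure set T -> \bar R}) (v : T -> T -> \bar R).
Variables (z : T -> R) (L : set T).
Hypotheses (v_ge0 : forall x y, (0 <= v x y)%E) (vC : forall x y, v x y = v y x).
Hypothesis mv : measurable_fun setT (fun p : T * T => v p.1 p.2).
Hypotheses (mz : measurable_fun setT z) (z_ge0 : forall x, 0 <= z x).
Hypotheses (mL : measurable L) (zL_fin : (\int[mu]_(x in L) (z x)%:E < +oo)%E).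
Local Open Scope ereal_scope.

Let f := mayer v.
(** The restriction to [L] sits in the weight, whose total mass is [c]; the results for the whole
    space then apply. *)
Let w x : R := (z x * \1_L x)%R.
Let c : R := fine (\int[mu]_(x in L) (z x)%:E).

Let f_le0 x y : (f x y <= 0)%R. Proof. exact: mayer_le0. Qed.
Let f_geN1 x y : (0 <= 1 + f x y)%R. Proof. exact: mayer_geN1. Qed.
Let fC x y : f x y = f y x. Proof. exact: mayerC. Qed.
Let mpsi : smeas2 (fun xs ys => (psir f xs ys)%:E). Proof. exact: smeas2_psir. Qed.
Let mboltz : smeas (fun s => (boltzr f s)%:E). Proof. exact: smeas_boltzr. Qed.

Let mw : measurable_fun setT w.
Proof. by apply: measurable_funM => //; exact: measurable_indic. Qed.
Let w_ge0 x : (0 <= w x)%R. Proof. by rewrite mulr_ge0. Qed.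

Let intL : \int[mu]_(x in L) (z x)%:E = c%:E.
Proof.
rewrite fineK // ge0_fin_numE //.
by apply: integral_ge0 => x _; rewrite lee_fin.
Qed.

Let intw : \int[mu]_x (w x)%:E = c%:E.
Proof.
rewrite -intL [RHS]integral_mkcond; apply: eq_integral => x _.
by rewrite /w /patch indicE; case: ifP => _; rewrite ?mulr1 ?mulr0.
Qed.

Lemma poissonE_sint (F : config_fun) (G : nat -> seq T -> \bar R) :
  (forall m (t : m.-tuple T), F m t = G m t) ->
  poissonE mu L z F = (expR (- c))%:E * \sum_(m <oo) (m`!%:R^-1)%:E * sint mu w m (G m).
Proof.
move=> FG; rewrite /poissonE intL; congr (_ * _); apply: eq_eseriesr => m _.
congr (_ * _); rewrite wint_mkcond /sint; congr wint.
by apply/funext => t; exact: FG.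
Qed.

Let Xi : \bar R := grand_partition mu f w.
Let Xi_ge1 : 1 <= Xi. Proof. exact: grand_partition_ge1. Qed.
Let Xi_fin : Xi \is a fin_num. Proof. exact: (grand_partition_fin f_le0 f_geN1 mboltz mw w_ge0 intw). Qed.
Let fXi_gt0 : (0 < fine Xi)%R.
Proof. by rewrite -lte_fin fineK //; apply: lt_le_trans Xi_ge1; rewrite lte_fin. Qed.

(** The explicit candidate for the correlation function; the weights make it vanish as soon as some
    entry lies outside [L]. *)
Definition density n (t : n.-tuple T) : \bar R :=
  (\prod_(j < n) w (tnth t j))%R%:E *
  ((fine Xi)^-1%:E * \sum_(j <oo) boltz_int mu f w j t).

Section Events.
Variables (x0 : T) (n : nat) (A : set (n.-tuple T)).
Hypothesis mA : measurable A.

Let g (u : seq T) : R := oapp (\1_A : n.-tuple T -> R) 0%R (insub u).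

Let gE (t : n.-tuple T) : g t = \1_A t.
Proof. by rewrite /g valK. Qed.

Let g0 u : (0 <= g u)%R.
Proof. by rewrite /g; case: insub => //= t. Qed.

Let mg : smeas (fun u => (g u)%:E).
Proof.
rewrite (_ : (fun _ => _) = seqext (fun t => (\1_A t)%:E)).
  by apply: smeas_seqext; apply/measurable_EFinP; exact: measurable_indic.
by apply/funext => u; rewrite /g /seqext; case: insub.
Qed.

(** Indicators as test functions are enough for [density_unique]. The Poisson prefactor [expR (- c)]
    occurs in the numerator and in the normalisation, and cancels. *)
Lemma gibbsE_event :
  gibbsE mu z v L (fact_sum (fun t : n.-tuple T => (\1_A t)%:E)) =
  wint mu setT (fun=> 1%R) (fun t => (\1_A t)%:E * density t).
Proof.
pose E s := (boltzr f s)%:E.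
rewrite /gibbsE (@poissonE_sint (boltz v) (fun _ => E)); last by move=> m t; exact: boltz_boltzr.
rewrite (@poissonE_sint _ (fun m y => fact_sum_seq x0 n g m y * E y) : _); last first.
  move=> m t; rewrite boltz_boltzr //; congr (_ * _).
  rewrite /fact_sum /fact_sum_seq; apply: eq_bigr => s _; congr EFin.
  rewrite -gE; congr g; rewrite /= /positions -map_comp; apply: eq_map => i /=.
  by rewrite (tnth_nth x0).
rewrite (factorial_moment mu fC f_geN1 mboltz mw w_ge0 x0 n mg g0).
have -> : \sum_(m <oo) (m`!%:R^-1)%:E * sint mu w m E = Xi by [].
have S0 u : 0 <= \sum_(j <oo) boltz_int mu f w j u.
  by apply: nneseries_ge0 => j _ _; exact: boltz_int_ge0.
have mS : smeas (fun u => \sum_(j <oo) boltz_int mu f w j u).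
  apply: smeas_nneseries => j; first exact: smeas_boltz_int.
  by move=> s; exact: boltz_int_ge0.
rewrite -(fineK Xi_fin) -EFinM /= muleAC -EFinM.
have -> : (expR (- c) * (expR (- c) * fine Xi)^-1 = (fine Xi)^-1)%R.
  by field; rewrite !gt_eqF ?expR_gt0.
rewrite -sintZ //; last 3 first.
- exact: smeasM.
- by move=> s; rewrite mule_ge0 ?lee_fin.
- by rewrite lee_fin invr_ge0 ltW.
rewrite sint_weight //; last 2 first.
- by apply: smeasM; [exact: smeas_cst|exact: smeasM].
- by move=> s; rewrite !mule_ge0 ?lee_fin // invr_ge0 ltW.
rewrite /sint; congr wint; apply/funext => t.
by rewrite gE /density big_tuple [in RHS]muleCA; congr (_ * _); rewrite muleCA.
Qed.

End Events.

Lemma boltz_series_le u : \sum_(j <oo) boltz_int mu f w j u <= Xi.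
Proof.
apply: lee_nneseries => [j _ _|j _]; first exact: boltz_int_ge0.
exact: boltz_int_le.
Qed.

Lemma boltz_series_ge0 u : 0 <= \sum_(j <oo) boltz_int mu f w j u.
Proof. by apply: nneseries_ge0 => j _ _; exact: boltz_int_ge0. Qed.

Lemma density_ge0 n (t : n.-tuple T) : 0 <= density t.
Proof.
by rewrite !mule_ge0 ?boltz_series_ge0 ?lee_fin ?prodr_ge0 ?invr_ge0 ?ltW.
Qed.

Lemma density_fin n (t : n.-tuple T) : density t \is a fin_num.
Proof.
rewrite !fin_numM // ge0_fin_numE ?boltz_series_ge0 //.
by apply: le_lt_trans (boltz_series_le _) _; rewrite -ge0_fin_numE // (le_trans _ Xi_ge1).
Qed.

Lemma measurable_density n : measurable_fun setT (@density n).
Proof.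
apply: emeasurable_funM.
  rewrite (_ : (fun _ => _) = fun t : n.-tuple T => (\prod_(y <- t) w y)%:E).
    exact: (smeas_prod mw).
  by apply/funext => t; rewrite big_tuple.
apply: emeasurable_funM; first exact: measurable_cst.
apply: smeas_nneseries => j; first exact: smeas_boltz_int.
by move=> s; exact: boltz_int_ge0.
Qed.

(** The Boltzmann series is at most [Xi], so the density is at most the product of the weights,
    whose integral is [c ^+ n]. *)
Lemma density_integral_lty n : wint mu setT (fun=> 1%R) (@density n) < +oo.
Proof.
have mS : smeas (fun u => (fine Xi)^-1%:E * \sum_(j <oo) boltz_int mu f w j u).
  apply: smeasM; first exact: smeas_cst.
  apply: smeas_nneseries => j; first exact: smeas_boltz_int.
  by move=> s; exact: boltz_int_ge0.
have S0 u : 0 <= (fine Xi)^-1%:E * \sum_(j <oo) boltz_int mu f w j u.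
  by rewrite mule_ge0 ?boltz_series_ge0 ?lee_fin ?invr_ge0 ?ltW.
have -> : wint mu setT (fun=> 1%R) (@density n) =
    sint mu w n (fun u => (fine Xi)^-1%:E * \sum_(j <oo) boltz_int mu f w j u).
  rewrite sint_weight // /sint; congr wint; apply/funext => t.
  by rewrite /density big_tuple.
apply: (@le_lt_trans _ _ (sint mu w n (fun=> 1))); last by rewrite (sint1E mw w_ge0 intw) ltry.
apply: le_sint => // s _.
rewrite muleC lee_pdivrMr // mul1e fineK //; exact: boltz_series_le.
Qed.

Lemma correlation_ae_density n (rho : n.-tuple T -> \bar R) :
  L !=set0 -> is_correlation_fun mu z v L rho ->
  exists B, [/\ measurable B, prodm mu B = 0 & forall t, ~ B t -> rho t = density t].
Proof.
move=> [x0 _] [mrho rho0 Hrho]; apply: density_unique => //.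
- exact: measurable_density.
- exact: density_ge0.
- exact: density_fin.
- exact: density_integral_lty.
move=> A mA; rewrite -(gibbsE_event x0 mA) Hrho //.
by apply/measurable_EFinP; exact: measurable_indic.
Qed.

(** For fixed [k] the integrand has the constant sign [(-1) ^+ k], so its positive or its negative
    part is zero and the signed integral involves no indeterminate difference. *)
Lemma swint_psi n k (x : n.-tuple T) :
  swint mu L z (fun y : k.-tuple T => (psi v n (cat_tuple x y))%:E) =
  ((-1) ^+ k)%:E * sint mu w k (fun y => `|psir f x y|%:E).
Proof.
have sgn (y : k.-tuple T) : psi v n (cat_tuple x y) = ((-1) ^+ k * `|psir f x y|)%R.
  by rewrite psi_cat_psir // {1}(psir_sign f f_le0 f_geN1) size_tuple.
rewrite /swint !(wint_mkcond _ L); set F := fun y : k.-tuple T => (psi v n _)%:E.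
pose G (y : k.-tuple T) : \bar R := `|psir f x y|%:E.
rewrite -signr_odd.
have sint0w : wint mu setT w (fun _ : k.-tuple T => 0 : \bar R) = 0 by exact: (sint0 mu w k).
have nge0 (r : R) : (0 <= `|r|)%R by [].
case: (boolP (odd k)) => ok.
- have -> : F^\+ = fun=> 0.
    apply/funext => y; rewrite funeposE /F sgn -signr_odd ok expr1 mulN1r.
    by apply/max_idPr; rewrite lee_fin oppr_le0.
  have -> : F^\- = G.
    apply/funext => y; rewrite funenegE /F sgn -signr_odd ok expr1 mulN1r EFinN oppeK.
    by apply/max_idPl; rewrite lee_fin.
  by rewrite sint0w sub0e expr1 mulN1e.
- have -> : F^\+ = G.
    apply/funext => y; rewrite funeposE /F sgn -signr_odd (negPf ok) expr0 mul1r.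
    by apply/max_idPl; rewrite lee_fin.
  have -> : F^\- = fun=> 0.
    apply/funext => y; rewrite funenegE /F sgn -signr_odd (negPf ok) expr0 mul1r.
    by apply/max_idPr; rewrite -EFinN lee_fin oppr_le0.
  by rewrite sint0w sube0 expr0 mul1e.
Qed.

Lemma density_expansion n (x : n.-tuple T) :
  \sum_(k <oo) psi_int mu f z k x < +oo -> (forall i, L (tnth x i)) ->
  density x = (\prod_(j < n) z (tnth x j))%R%:E * ((psi v n x)%:E +
    \sum_(1 <= k <oo) ((k`!%:R)^-1%:E *
       swint mu L z (fun y : k.-tuple T => (psi v n (cat_tuple x y))%:E))).
Proof.
move=> xz xL.
(* Summability is known over the whole space; as [w <= z], it carries over to [L]. *)
have psiwz k : psi_int mu f w k x <= psi_int mu f z k x.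
  rewrite lee_wpmul2l //; apply: sint_le_weight => //.
  - by move=> y; rewrite /w indicE; case: (y \in L); rewrite ?mulr1 ?mulr0.
  - exact: smeas2r (smeas2_norm_psir mpsi).
have xw : \sum_(k <oo) psi_int mu f w k x < +oo.
  apply: le_lt_trans xz; apply: lee_nneseries => [k _ _|k _]; last exact: psiwz.
  exact: psi_int_ge0.
rewrite /density; congr (_ * _).
  by congr EFin; apply: eq_bigr => j _; rewrite /w indicE mem_set ?mulr1.
rewrite (boltz_series_expansion fC f_le0 f_geN1 mpsi mboltz mw w_ge0 intw xw).
congr (_ + _).
  rewrite /psi_int fact0 invr1 mul1e /sint /= psi_tuple_psir //.
  by rewrite [in RHS](psir_sign f f_le0 f_geN1) /= expr0 mul1r.
apply: eq_eseriesr => k _; rewrite swint_psi muleCA EFinM; congr (_ * _).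
rewrite fineK // ge0_fin_numE ?psi_int_ge0 //; apply: le_lt_trans xw.
apply: le_trans (nneseries_lim_ge k.+1 _); last by move=> m _ _; exact: psi_int_ge0.
by rewrite big_nat_recr //= leeDr // sume_ge0 // => m _; exact: psi_int_ge0.
Qed.

End GibbsMeasure.

Section SigmaFinite.
Context {d : measure_display} {T : measurableType d} {R : realType}.
Variables (lam : {measure set T -> \bar R}) (lam_sf : sigma_finite setT lam).

(** A copy of [lam] that takes the proof as an argument, so that sigma-finiteness can be declared as
    an instance. It unfolds to [lam], and statements pass between the two by conversion. *)
Definition as_sigma_finite of sigma_finite setT lam : set T -> \bar R := lam.

HB.instance Definition _ := Measure.copy (as_sigma_finite lam_sf) lam.
HB.instance Definition _ := @Measure_isSigmaFinite.Build _ _ _ (as_sigma_finite lam_sf) lam_sf.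

End SigmaFinite.

(** * From the convergence condition to the theorem *)

Section MainBound.
Context {d : measure_display} {T : measurableType d} {R : realType}.
Variables (mu : {sigma_finite_measure set T -> \bar R}) (v : T -> T -> \bar R).
Variables (z a : T -> R).
Hypotheses (v_ge0 : forall x y, (0 <= v x y)%E) (vC : forall x y, v x y = v y x).
Hypothesis mv : measurable_fun setT (fun p : T * T => v p.1 p.2).
Hypotheses (mz : measurable_fun setT z) (z_ge0 : forall x, 0 <= z x).
Hypothesis ma : measurable_fun setT a.
Local Open Scope ereal_scope.

Definition ks_condition (x0 : T) : Prop :=
  \sum_(1 <= k <oo)
     ((k`!%:R)^-1%:E *
      wint mu setT (fun=> 1%R) (fun y : k.-tuple T =>
        ((\prod_(j < k) `|mayer v x0 (tnth y j)|) *
         (\prod_(i < k) \prod_(j < k | (i < j)%N)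
             (1 + mayer v (tnth y i) (tnth y j))) *
         (\prod_(j < k) (z (tnth y j) * expR (a (tnth y j)))))%R%:E))
  <= (expR (a x0) - 1)%R%:E.

Let f := mayer v.

Lemma ks_condition_sint x : ks_condition x ->
  \sum_(1 <= k <oo) ((k`!%:R^-1)%:E * sint mu z k (ks_weight f a x)) <= (expR (a x) - 1)%:E.
Proof.
apply: le_trans; rewrite le_eqVlt; apply/orP; left; apply/eqP.
apply: eq_eseriesr => k _; congr (_ * _).
rewrite sint_weight //; last 2 first.
- apply: smeas_ks_weight => //; first exact: measurable_mayer.
  exact: smeas_boltzr.
- by move=> s; apply: ks_weight_ge0; exact: mayer_geN1.
rewrite /sint; congr wint; apply/funext => t; rewrite /ks_weight -EFinM; congr EFin.
rewrite !big_tuple boltzr_tuple big_split /=; ring.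
Qed.

Lemma psi_bound_ae (good : set T) n (x : n.-tuple T) :
  measurable good -> mu (~` good) = 0 -> (forall y, good y -> ks_condition y) ->
  (forall i, good (tnth x i)) ->
  \sum_(k <oo) psi_int mu f z k x <=
  ((\prod_(i < n) \prod_(j < n | (i < j)%N) (1 + mayer v (tnth x i) (tnth x j))) *
   expR (\sum_(i < n) a (tnth x i)))%R%:E.
Proof.
move=> mg g0 ks gx; rewrite expR_sum -boltzr_tuple -(big_tuple _ _ _ xpredT (fun y => expR (a y))).
apply: (psi_series_le _ _ _ _ _ _ _ ma mg g0) => //.
- exact: mayer_le0.
- exact: mayer_geN1.
- exact: measurable_mayer.
- exact: smeas2_psir.
- exact: smeas_boltzr.
- by move=> y /ks; exact: ks_condition_sint.
- by move=> y /tnthP[i ->].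
Qed.

Lemma psi_series_split n (x : n.-tuple T) :
  (`|psi v n x|)%:E + \sum_(1 <= k <oo) ((k`!%:R)^-1%:E *
     wint mu setT z (fun y : k.-tuple T => (`|psi v n (cat_tuple x y)|)%:E)) =
  \sum_(k <oo) psi_int mu f z k x.
Proof.
rewrite [RHS](nneseries_split 0 1); last by move=> k _; exact: psi_int_ge0.
rewrite add0n big_nat1; congr (_ + _).
  by rewrite /psi_int fact0 invr1 mul1e /sint /= psi_tuple_psir.
apply: eq_eseriesr => k _; congr (_ * _); rewrite /sint; congr wint.
by apply/funext => y; rewrite psi_cat_psir.
Qed.

End MainBound.
Unset Implicit Arguments.
Set Strict Implicit.
Theorem mainTheorem6 (d : measure_display) (T : measurableType d) (R : realType)
  (dist : T -> T -> R) (lam : {measure set T -> \bar R})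
  (v : T -> T -> \bar R) (z : T -> R) (a : T -> R) :
  (* (X, dist) complete separable metric space, X its Borel sigma-algebra *)
  is_metric dist -> metric_complete dist -> metric_separable dist -> borel_of dist ->
  (* lambda finite on bounded sets *)
  (forall B : set T, measurable B -> mbounded dist B -> (lam B < +oo)%E) ->
  (* v measurable, symmetric, [0,oo]-valued *)
  measurable_fun [set: T * T] (fun p : T * T => v p.1 p.2) ->
  (forall x y, (0 <= v x y)%E) -> (forall x y, v x y = v y x) ->
  (* z measurable, nonnegative, locally integrable *)
  measurable_fun [set: T] z -> (forall x, 0 <= z x) ->
  (forall B : set T, measurable B -> mbounded dist B ->
     (\int[lam]_(x in B) (z x)%:E < +oo)%E) ->
  (* a measurable, nonnegative, satisfying the Kotecky-Preiss type condition *)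
  measurable_fun [set: T] a -> (forall x, 0 <= a x) ->
  {ae lam, forall x0 : T,
     (\sum_(1 <= k <oo)
        ((k`!%:R)^-1%:E *
         wint lam setT (fun=> 1%R) (fun y : k.-tuple T =>
           ((\prod_(j < k) `|mayer v x0 (tnth y j)|) *
            (\prod_(i < k) \prod_(j < k | (i < j)%N)
                (1 + mayer v (tnth y i) (tnth y j))) *
            (\prod_(j < k) (z (tnth y j) * expR (a (tnth y j)))))%R%:E))
      <= (expR (a x0) - 1)%R%:E)%E} ->
  (forall n : nat,
     ae_prod lam (fun x : n.-tuple T =>
       ((`|psi v n x|)%:E +
        \sum_(1 <= k <oo)
          ((k`!%:R)^-1%:E *
           wint lam setT z (fun y : k.-tuple T => (`|psi v n (cat_tuple x y)|)%:E))
        <= ((\prod_(i < n) \prod_(j < n | (i < j)%N)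
               (1 + mayer v (tnth x i) (tnth x j))) *
            expR (\sum_(i < n) a (tnth x i)))%R%:E)%E))
  /\
  (forall L : set T, measurable L -> mbounded dist L ->
     (0 < \int[lam]_(x in L) (z x)%:E)%E ->
     forall (n : nat) (rho : n.-tuple T -> \bar R),
       is_correlation_fun lam z v L rho ->
       ae_prod lam (fun x : n.-tuple T =>
         (forall i : 'I_n, L (tnth x i)) ->
         rho x =
         ((\prod_(j < n) z (tnth x j))%R%:E *
          ((psi v n x)%:E +
           \sum_(1 <= k <oo)
             ((k`!%:R)^-1%:E *
              swint lam L z (fun y : k.-tuple T => (psi v n (cat_tuple x y))%:E))))%E)).
Proof.
move=> hdist _ _ hbor lam_fin mv v_ge0 vC mz z_ge0 z_fin ma _ ae_ks.
have lam_sf : sigma_finite setT lam by exact: sigma_finite_bounded hdist hbor lam_fin.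
pose mu : {sigma_finite_measure set T -> \bar R} := as_sigma_finite lam_sf.
have [N [mN N0 ksN]] := ae_ks.
have mg : measurable (~` N) by exact: measurableC.
have g0 : mu (~` ~` N) = 0 by rewrite setCK.
have ks y : (~` N) y -> ks_condition mu v z a y.
  by move=> Ny; apply: contrapT => nks; apply: Ny; exact: ksN.
have bound n (x : n.-tuple T) (gx : forall i, (~` N) (tnth x i)) :=
  psi_bound_ae v_ge0 vC mv mz z_ge0 ma mg g0 ks gx.
split=> [n|L mL bL zL_gt0 n rho Hrho].
  (* For the bound, every exceptional tuple has a coordinate in [N], so the additional null set is
     empty. *)
  apply: (@ae_prod_good _ _ _ mu n (~` N) set0) => //.
    rewrite /prodm (_ : (fun _ => _) = fun=> 0%E); first exact: (sint0 mu (fun=> 1) n).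
    by apply/funext => t; rewrite indic0.
  move=> x _ gx; have := bound n x gx.
  by rewrite -psi_series_split.
(* Positive mass gives a point of [L], the default value needed to read entries of sequences. *)
have L0 : L !=set0.
  apply/set0P/eqP => L0; move: zL_gt0; rewrite L0 integral_set0 ltxx //.
have zL : (\int[mu]_(x in L) (z x)%:E < +oo)%E by exact: z_fin.
have Hrho' : is_correlation_fun mu z v L rho := Hrho.
have [B [mB B0 BE]] := @correlation_ae_density _ _ _ mu v z L
  v_ge0 vC mv mz z_ge0 mL zL n rho L0 Hrho'.
apply: (@ae_prod_good _ _ _ mu n (~` N) B) => // x Bx gx Lx.
rewrite BE //; apply: (@density_expansion _ _ _ mu v z L v_ge0 vC mv mz z_ge0 mL zL) => //.
by apply: le_lt_trans (bound n x gx) _; exact: ltry.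
Qed.
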